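(* Let $X$ be a smooth complex manifold and let $w\in H^0(X,S^2\Omega^1_X)$ be a closed differential of rank 2. Then the locus where $w$ fails to be of the 1st kind (i.e. the set of points of $X$ at which $w$ has no holomorphic exact decomposition) is contained in the degeneracy locus $D_w$ of $w$.
   Context: Manifolds are connected. A holomorphic exact decomposition of $w\in H^0(X,S^2\Omega^1_X)$ at $x$ is an equality $w|_{U_x}=df_1\,df_2$ on a neighborhood $U_x$ of $x$, with $f_1,f_2\in\mathcal{O}(U_x)$. The differential $w$ is closed if it has a holomorphic exact decomposition at a general point of $X$ (i.e. at every point outside some proper closed analytic subset); it is closed of the 1st kind if it has one at every point. It has rank 2 if at a general point $x$ the form $w(x)$ is a product of two linearly independent linear forms on $T_xX$, i.e. defines exactly two distinct hyperplanes in $T_xX$. The degeneracy locus $D_w$ is the set of points $x\in X$ such that $w(x)=0$ or the number of distinct hyperplanes in $T_xX$ defined by $w(x)$ is less than 2. *)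

(* Defs.v *)
From HB Require Import structures.
From mathcomp Require Import all_boot all_order all_algebra.
From mathcomp Require Import complex.
From mathcomp Require Import boolp classical_sets functions cardinality reals.
From mathcomp Require Import topology normedtype derive.

Set Implicit Arguments.
Unset Strict Implicit.
Unset Printing Implicit Defensive.

Import Order.TTheory GRing.Theory Num.Theory.
Import numFieldNormedType.Exports.

Local Open Scope classical_set_scope.
Local Open Scope card_scope.
Local Open Scope ring_scope.

(* Giving [R[i]] the explicit type [numFieldType] makes it inherit the topology
   and the normed module structure (over itself) of MathComp-Analysis.  Then
   [differentiable] and ['d] for maps between the spaces ['rV[CC R]_n] are
   complex differentiability and the complex differential, and "holomorphic on
   an open set" means differentiable at each of its points. *)
Definition CC (R : realType) : numFieldType := R[i].

(* The values of [cm_map i] outside [cm_dom i], and those of [cm_inv i] outside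
   the open set [cm_map i @` cm_dom i], are irrelevant. *)
Record complexManifold (R : realType) (n : nat) := ComplexManifold {
  cm_space :> topologicalType;
  cm_hausdorff : hausdorff_space cm_space;
  cm_second_countable : @second_countable cm_space;
  cm_connected : connected [set: cm_space];
  cm_chart : Type;
  cm_dom : cm_chart -> set cm_space;
  cm_map : cm_chart -> cm_space -> 'rV[CC R]_n;
  cm_inv : cm_chart -> 'rV[CC R]_n -> cm_space;
  cm_cover : forall p, exists i, cm_dom i p;
  cm_open_dom : forall i, open (cm_dom i);
  cm_open_cod : forall i, open (cm_map i @` cm_dom i);
  cm_mapK : forall i p, cm_dom i p -> cm_inv i (cm_map i p) = p;
  cm_map_continuous : forall i, {within cm_dom i, continuous (cm_map i)};
  cm_inv_continuous :
    forall i, {within cm_map i @` cm_dom i, continuous (cm_inv i)};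
  cm_transition_holomorphic : forall i j p, cm_dom i p -> cm_dom j p ->
    differentiable (cm_map j \o cm_inv i) (cm_map i p)
}.

Section ComplexManifoldTheory.
Context {R : realType} {n : nat} {X : complexManifold R n}.
Local Notation C := (CC R).
Implicit Types (p x : X) (U A : set X) (f : X -> C).

(* Meant for open [U]; only the values of [f] on [U] matter. *)
Definition holomorphic_on U f : Prop :=
  forall i p, U p -> cm_dom i p ->
    differentiable (f \o cm_inv i : 'rV[C]_n -> C) (cm_map i p).

(* [U] ranges over neighborhoods of all points of [X], not only of those of
   [A], so that [A] is closed. *)
Definition closed_analytic A : Prop :=
  forall x, exists2 U, open U /\ U x &
    exists (k : nat) (g : 'I_k -> X -> C),
      (forall i, holomorphic_on U (g i)) /\
      A `&` U = [set p | U p /\ forall i, g i p = 0].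

Definition at_general_point (P : X -> Prop) : Prop :=
  exists A, [/\ closed_analytic A, A != [set: X] & forall x, ~ A x -> P x].

(* T_pX is identified with ['rV[C]_n] by means of a fixed chart at [p]. *)
Definition chart_at p : cm_chart X := sval (cid (cm_cover p)).

Definition dfun f p : 'rV[C]_n -> C :=
  'd (f \o cm_inv (chart_at p) : 'rV[C]_n -> C) (cm_map (chart_at p) p).

End ComplexManifoldTheory.

(* A section of S^2 Omega^1 over X is given by its local expressions
   w = sum_(a, b) (sd_coef i a b) dz_a dz_b on the charts: symmetric matrices of
   holomorphic functions which transform by the Jacobian matrices of the
   changes of charts (['J] acts on row vectors: 'd h z v = v *m 'J h z). *)
Record symDiff2 (R : realType) (n : nat) (X : complexManifold R n) := SymDiff2 {
  sd_coef : cm_chart X -> 'rV[CC R]_n -> 'M[CC R]_n;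
  sd_sym : forall i p, cm_dom i p ->
    (sd_coef i (cm_map i p))^T = sd_coef i (cm_map i p);
  sd_holomorphic : forall i p, cm_dom i p -> forall a b : 'I_n,
    differentiable ((fun z => sd_coef i z a b) : 'rV[CC R]_n -> CC R)
      (cm_map i p);
  sd_transition : forall i j p, cm_dom i p -> cm_dom j p ->
    let J := 'J (cm_map j \o cm_inv i) (cm_map i p) in
    sd_coef i (cm_map i p) = J *m sd_coef j (cm_map j p) *m J^T
}.

Section QuadraticForms.
Context {R : realType} {n : nat}.
Local Notation C := (CC R).
Local Notation linform := 'Hom('rV[C]_n, C^o).
Implicit Types (q : 'rV[C]_n -> C) (a b : linform).

Definition is_product q a b : Prop := forall v, q v = a v * b v.

(* The hyperplanes defined by [q] are the kernels of the nonzero linear forms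
   dividing [q]: there are none if [q] is not a product of linear forms. *)
Definition hyperplanes q : set {vspace 'rV[C]_n} :=
  [set H | exists a b, [/\ a != 0, H = lker a & is_product q a b]].

End QuadraticForms.

Section SymmetricDifferentials.
Context {R : realType} {n : nat} {X : complexManifold R n}.
Local Notation C := (CC R).
Local Notation linform := 'Hom('rV[C]_n, C^o).
Implicit Types (w : symDiff2 X) (x p : X).

(* The value w(p), as a quadratic form on T_pX. *)
Definition sd_at w p : 'rV[C]_n -> C :=
  fun v => (v *m sd_coef w (chart_at p) (cm_map (chart_at p) p) *m v^T) 0 0.

Definition has_exact_decomposition w x : Prop :=
  exists (U : set X) (f1 f2 : X -> C),
    [/\ open U, U x, holomorphic_on U f1, holomorphic_on U f2 &
        forall p, U p -> forall v, sd_at w p v = dfun f1 p v * dfun f2 p v].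

Definition closed_differential w : Prop :=
  at_general_point (has_exact_decomposition w).

Definition rank2 w : Prop :=
  at_general_point (fun x => exists a b : linform,
    is_product (sd_at w x) a b /\ free [:: a; b]).

Definition degeneracy_locus w : set X :=
  [set x | (forall v, sd_at w x v = 0) \/ (hyperplanes (sd_at w x) #<= `I_1)].

Definition non_first_kind_locus w : set X :=
  [set x | ~ has_exact_decomposition w x].

End SymmetricDifferentials.

(* Main.v *)
Require Import Defs.
From HB Require Import structures.
From mathcomp Require Import all_boot all_order all_algebra.
From mathcomp Require Import complex.
From mathcomp Require Import boolp classical_sets functions cardinality reals.
From mathcomp Require Import topology ereal normedtype landau derive.
From mathcomp Require Import sequences exp trigo.
From mathcomp Require Import measure lebesgue_measure lebesgue_integral ftc.
From mathcomp Require Import ring lra.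

(* At a point outside D_w one can write w = c * alpha * beta with c nowhere zero
   and alpha, beta linearly independent holomorphic 1-forms, normalized by
   alpha(e1) = beta(e2) = 1; this only needs a square root of the discriminant
   of w on the span of e1, e2, and w being a product of linear forms on a dense
   set of points.  Where w = df1 df2 one has, up to exchanging f1 and f2,
   u alpha = df1 and (c / u) beta = df2 with u = df1(e1).  The closedness of
   these two forms determines theta = du / u as an expression in the first
   derivatives of c, alpha and beta, so theta is a holomorphic 1-form defined on
   a whole ball.  It is closed on a dense set, hence closed, and theta = dh by
   the Poincare lemma.  The forms exp(h) alpha and c exp(-h) beta are then closed
   for the same reason, and their primitives decompose w.

   The required complex analysis is obtained from the mean value property on
   circles, which follows from Goursat's theorem on rectangles transported by
   the exponential: it expresses 'd f z v as a mean of difference quotients of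
   f over a circle of directions, whence the Cauchy estimates, the
   differentiability of 'd f and the symmetry of second derivatives.  The
   density of the points where w is decomposed is the identity theorem, deduced
   from the maximum principle applied to f(z) / z^k for all k. *)

Set Implicit Arguments.
Unset Strict Implicit.
Unset Printing Implicit Defensive.

Import Order.TTheory GRing.Theory Num.Theory.
Import numFieldNormedType.Exports.

Local Open Scope classical_set_scope.
Local Open Scope ring_scope.

(** Decompositions are not unique: (k f1, f2 / k) serves as well as (f1, f2). Those found at nearby
    general points need not agree, and following one around the exceptional analytic set may
    multiply df1 by a constant, so df1 itself has no reason to extend to a full ball. The
    logarithmic derivative theta = du / u does not see the constant, and the normalization alpha(e1)
    = 1 makes it depend on w alone. Every relation needed, namely d theta = 0, d alpha = - theta ^
    alpha, d(c beta) = theta ^ (c beta) and w = c alpha beta, then equates functions holomorphic on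
    the whole ball, so that checking it on a dense set is enough. Being outside D_w matters for the
    square root: in a basis dual to the two linear factors of w at the point, the discriminant is
    1/4 there and c = 1, so the principal root is holomorphic nearby and no denominator vanishes. *)

(** * Complex numbers and real norms *)

Section ComplexNumbers.
Context {R : realType}.
Local Notation C := (CC R).

Definition cR (x : R) : C := (x%:C)%C.
Definition cI : C := Complex 0 1.
Definition re (z : C) : R := complex.Re z.
Definition im (z : C) : R := complex.Im z.

Lemma re_cR x : re (cR x) = x. Proof. by []. Qed.
Lemma im_cR x : im (cR x) = 0. Proof. by []. Qed.
Lemma reD z w : re (z + w) = re z + re w. Proof. by case: z; case: w. Qed.
Lemma imD z w : im (z + w) = im z + im w. Proof. by case: z; case: w. Qed.
Lemma reN z : re (- z) = - re z. Proof. by case: z. Qed.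
Lemma imN z : im (- z) = - im z. Proof. by case: z. Qed.
Lemma reM z w : re (z * w) = re z * re w - im z * im w.
Proof. by case: z; case: w. Qed.
Lemma imM z w : im (z * w) = re z * im w + im z * re w.
Proof. by case: z; case: w. Qed.
Lemma C_eq z w : re z = re w -> im z = im w -> z = w.
Proof. by case: z => a b; case: w => c d /= -> ->. Qed.
Lemma re_cI : re cI = 0. Proof. by []. Qed.
Lemma im_cI : im cI = 1. Proof. by []. Qed.
Lemma re0 : re 0 = 0. Proof. by []. Qed.
Lemma re1 : re 1 = 1. Proof. by []. Qed.
Lemma im1 : im 1 = 0. Proof. by []. Qed.

Lemma cR0 : cR 0 = 0. Proof. by []. Qed.
Lemma cR1 : cR 1 = 1. Proof. by []. Qed.
Lemma cRD x y : cR (x + y) = cR x + cR y. Proof. exact: rmorphD. Qed.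
Lemma cRB x y : cR (x - y) = cR x - cR y. Proof. exact: rmorphB. Qed.
Lemma cRM x y : cR (x * y) = cR x * cR y. Proof. exact: rmorphM. Qed.
Lemma cRV x : cR (x^-1) = (cR x)^-1. Proof. exact: fmorphV. Qed.
Lemma cR_eq0 x : (cR x == 0) = (x == 0). Proof. exact: fmorph_eq0. Qed.
Lemma le_cR x y : (cR x <= cR y) = (x <= y). Proof. exact: lecR. Qed.
Lemma lt_cR x y : (cR x < cR y) = (x < y). Proof. exact: ltcR. Qed.

Section RealNorm.
Context {V : normedModType C}.

(** Norms on a module over [C] are themselves elements of [C]; the real part brings them to [R],
    where [lra] and [nra] work and suprema exist. *)
Definition nm (v : V) : R := re `|v|.

Lemma nmE (v : V) : `|v| = cR (nm v).
Proof.
have : 0 <= `|v| by exact: normr_ge0.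
by rewrite lecE => /andP[/eqP h _]; apply: C_eq.
Qed.
Lemma nm_ge0 v : 0 <= nm v.
Proof. by rewrite -le_cR -nmE normr_ge0. Qed.
Lemma nm0 : nm 0 = 0. Proof. by rewrite /nm normr0. Qed.
Lemma nm_eq0 v : (nm v == 0) = (v == 0).
Proof. by rewrite -cR_eq0 -nmE normr_eq0. Qed.
Lemma nm_gt0 v : (0 < nm v) = (v != 0).
Proof. by rewrite lt_def nm_ge0 nm_eq0 andbT. Qed.
Lemma nmN v : nm (- v) = nm v. Proof. by rewrite /nm normrN. Qed.
Lemma nmD v w : nm (v + w) <= nm v + nm w.
Proof. by rewrite -le_cR cRD -!nmE ler_normD. Qed.
Lemma nmB v w : nm (v - w) <= nm v + nm w.
Proof. by rewrite -(nmN w) nmD. Qed.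
Lemma nmBC v w : nm (v - w) = nm (w - v).
Proof. by rewrite -nmN opprB. Qed.
End RealNorm.

Lemma nmZ (V : normedModType C) (k : C) (v : V) : nm (k *: v) = nm k * nm v.
Proof. by apply: (@complexI R); rewrite -/(cR _) -/(cR (_ * _)) cRM -!nmE normrZ. Qed.
Lemma nmM (z w : C) : nm (z * w) = nm z * nm w.
Proof. by apply: (@complexI R); rewrite -/(cR _) -/(cR (_ * _)) cRM -!nmE normrM. Qed.
Lemma nmV (z : C) : nm z^-1 = (nm z)^-1.
Proof. by apply: (@complexI R); rewrite -/(cR _) -/(cR (_ ^-1)) cRV -!nmE normfV. Qed.
Lemma nm1 : nm (1 : C) = 1. Proof. by rewrite /nm normr1. Qed.
Lemma nmX (z : C) k : nm (z ^+ k) = nm z ^+ k.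
Proof. by elim: k => [|k IH]; rewrite ?expr0 ?nm1// !exprS nmM IH. Qed.
Lemma nm_def (z : C) : nm z = Num.sqrt (re z ^+ 2 + im z ^+ 2).
Proof. by rewrite /nm normc_def. Qed.
Lemma nm_sqr (z : C) : nm z ^+ 2 = re z ^+ 2 + im z ^+ 2.
Proof. by rewrite nm_def sqr_sqrtr// addr_ge0// sqr_ge0. Qed.
Lemma nm_cR x : nm (cR x) = `|x|.
Proof. by rewrite nm_def re_cR im_cR expr0n addr0 sqrtr_sqr. Qed.
Lemma nm_cI : nm (cI : C) = 1.
Proof. by rewrite nm_def re_cI im_cI expr0n add0r expr1n sqrtr1. Qed.
Lemma re_le_nm (z : C) : `|re z| <= nm z.
Proof. by rewrite nm_def -sqrtr_sqr ler_wsqrtr// lerDl sqr_ge0. Qed.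
Lemma im_le_nm (z : C) : `|im z| <= nm z.
Proof. by rewrite nm_def -sqrtr_sqr ler_wsqrtr// lerDr sqr_ge0. Qed.
Lemma nm_le_re_im (z : C) : nm z <= `|re z| + `|im z|.
Proof.
rewrite -(@ler_pXn2r _ 2)// ?nnegrE ?nm_ge0 ?addr_ge0//.
by rewrite nm_sqr sqrrD !real_normK ?num_real// addrAC lerDl mulrn_wge0// mulr_ge0.
Qed.

Lemma nearP (V : normedModType C) (x : V) (P : V -> Prop) :
  (\forall y \near x, P y) <->
  exists d : R, 0 < d /\ forall h, nm h < d -> P (x + h).
Proof.
split.
- move=> /nbhs_normP[d /= d0 hd].
  (* A positive element of [C] is real, because the order compares only numbers with equal imaginary
     parts; hence real radii suffice. *)
  have dE : d = cR (re d).
    by move: d0; rewrite ltcE => /andP[/eqP h _]; apply: C_eq.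
  move: d0 hd; rewrite dE lt_cR => d0 hd; exists (re d); split => // h hh.
  by apply: hd => /=; rewrite opprD addNKr normrN nmE lt_cR.
- move=> [d [d0 hd]]; apply/nbhs_normP; exists (cR d); first by rewrite /= lt_cR.
  move=> y /= hy; rewrite -(subrK x y) addrC; apply: hd.
  by rewrite nmBC -lt_cR -nmE.
Qed.

Lemma cont_epsP (V W : normedModType C) (f : V -> W) x :
  {for x, continuous f} <-> forall e : R, 0 < e ->
   exists d : R, 0 < d /\ forall h, nm h < d -> nm (f (x + h) - f x) < e.
Proof.
split.
- move=> /cvgrPdist_lt fx e e0.
  have : (0 : C) < cR e by rewrite lt_cR.
  move=> /fx/nearP[d [d0 hd]]; exists d; split => // h /hd.
  by rewrite nmE lt_cR nmBC.
- move=> H; apply/cvgrPdist_lt => e e0.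
  have eE : e = cR (re e).
    by move: e0; rewrite ltcE => /andP[/eqP h _]; apply: C_eq.
  move: e0; rewrite eE lt_cR => /H [d [d0 hd]]; apply/nearP; exists d; split => // h /hd.
  by rewrite nmE lt_cR nmBC.
Qed.

Lemma diff_eps (V W : normedModType C) (f : V -> W) x : differentiable f x ->
  forall e : R, 0 < e -> exists d : R, 0 < d /\
    forall h, nm h < d -> nm (f (x + h) - f x - 'd f x h) <= e * nm h.
Proof.
move=> /diff_locallyP[_ /eqaddoP H] e e0.
have e0' : (0 : C) < cR e by rewrite lt_cR.
have /nearP[d [d0 hd]] := H _ e0'.
exists d; split => // h /hd; rewrite add0r !nmE -cRM le_cR.
rewrite [in X in X -> _]/= => le_h; apply: le_trans le_h.
by rewrite -[X in _ <= nm X]/(f (h + x) - (f x + 'd f x h)) opprD addrA [h + x]addrC.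
Qed.

(** [differentiable] includes continuity of the differential. The bound by [K] supplies it, so a
    candidate differential can be a bare function with a proof of linearity. *)
Lemma eps_diff (V W : normedModType C) (f : V -> W) x (L : V -> W) (K : R) :
  linear L -> (forall h, nm (L h) <= K * nm h) ->
  (forall e : R, 0 < e -> exists d : R, 0 < d /\
    forall h, nm h < d -> nm (f (x + h) - f x - L h) <= e * nm h) ->
  differentiable f x /\ 'd f x = L :> (V -> W).
Proof.
move=> linL bL H.
pose L' : {linear V -> W} := HB.pack L (GRing.isLinear.Build _ _ _ _ L linL).
have cL : continuous L'.
  move=> y; apply/cont_epsP => e e0.
  exists (e / (`|K| + 1)); split; first by rewrite divr_gt0// ltr_wpDl.
  move=> h; rewrite ltr_pdivlMr ?ltr_wpDl// => hh.
  rewrite -linearB/= addrC addKr; apply: le_lt_trans (bL h) _.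
  have : K * nm h <= nm h * `|K|.
    by rewrite mulrC ler_wpM2l ?nm_ge0// ler_norm.
  move: hh; rewrite mulrDr mulr1; have := nm_ge0 h; lra.
have EL : f \o shift x = cst (f x) + L' +o_ 0 id.
  apply/eqaddoP => e e0.
  have eE : e = cR (re e).
    by move: e0; rewrite ltcE => /andP[/eqP h _]; apply: C_eq.
  move: e0; rewrite eE lt_cR => /H [d [d0 hd]]; apply/nearP; exists d; split => // h /hd.
  rewrite add0r !nmE -cRM le_cR => le_h; apply: le_trans le_h.
  by rewrite -[X in nm X <= _]/(f (h + x) - (f x + L h)) opprD addrA [h + x]addrC.
have dE := diff_unique cL EL; split => //.
apply/diff_locallyP; rewrite dE; split => //.
Qed.
End ComplexNumbers.

(** * Complex-valued functions of a real variable *)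

Section RealCurves.
Context {R : realType}.
Local Notation C := (CC R).
Implicit Types (F G P : R -> C) (t : R).

(** The variable is real and the values are complex, so source and target are normed over different
    fields; the derivative is therefore an explicit first-order expansion. *)
Definition rder F t (d : C) := forall e : R, 0 < e -> exists2 r : R, 0 < r &
  forall h, `|h| < r -> nm (F (t + h) - F t - cR h * d) <= e * `|h|.

Definition rcont F t := forall e : R, 0 < e -> exists2 r : R, 0 < r &
  forall h, `|h| < r -> nm (F (t + h) - F t) < e.

Lemma rderB F G t d d' : rder F t d -> rder G t d' ->
  rder (fun s => F s - G s) t (d - d').
Proof.
move=> hF hG e e0; have e20 : 0 < e / 2 by rewrite divr_gt0.
have [r r0 hr] := hF _ e20; have [r' r'0 hr'] := hG _ e20.
exists (Num.min r r'); first by rewrite lt_min r0.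
move=> h; rewrite lt_min => /andP[/hr h1 /hr' h2].
rewrite (_ : _ - _ = (F (t + h) - F t - cR h * d) - (G (t + h) - G t - cR h * d')).
  by apply: le_trans (nmB _ _) _; lra.
by ring.
Qed.

Lemma rderZ F t d k : rder F t d -> rder (fun s => k * F s) t (k * d).
Proof.
move=> hF e e0; have k0 := nm_ge0 k.
have [|r r0 hr] := hF (e / (nm k + 1)); first by rewrite divr_gt0// ltr_wpDl.
exists r => // h /hr; rewrite -mulrAC ler_pdivlMr ?ltr_wpDl// => H.
rewrite (_ : _ - _ = k * (F (t + h) - F t - cR h * d)); last by ring.
rewrite nmM; apply: le_trans H; rewrite mulrC ler_wpM2l ?nm_ge0//; lra.
Qed.

Lemma is_derive_eps (f : R -> R) t d :
  (forall e : R, 0 < e -> exists2 r : R, 0 < r &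
    forall h, `|h| < r -> `|f (t + h) - f t - h * d| <= e * `|h|) <->
  is_derive t 1 f d.
Proof.
split.
- move=> H; have Hd : h^-1 *: (f (h *: 1 + t) - f t) @[h --> 0^'] --> d.
    apply/cvgrPdist_le => e e0; have [r r0 hr] := H _ e0.
    rewrite near_withinE; apply/nbhs_normP; exists r => // h /=.
    rewrite add0r normrN => /hr hh h0.
    have hn : 0 < `|h| by rewrite normr_gt0.
    rewrite -(ler_pM2l hn) -normrM [leRHS]mulrC; apply: le_trans hh.
    rewrite le_eqVlt -[X in X == _]normrN; apply/orP; left; apply/eqP; congr `| _ |.
    by rewrite /GRing.scale/= mulr1 (addrC h t); field.
  apply: DeriveDef; first by apply/cvg_ex; exists d.
  by apply: (cvg_lim _ Hd); exact: norm_hausdorff.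
- move=> [/cvg_ex[l hl] dE] e e0.
  have ld : l = d.
    by rewrite -dE; apply/esym; apply: (cvg_lim _ hl); exact: norm_hausdorff.
  move: hl; rewrite ld => /cvgrPdist_le /(_ _ e0).
  rewrite near_withinE => /nbhs_normP[r r0 hr]; exists r => // h hh.
  have [->|h0] := eqVneq h 0; first by rewrite addr0 subrr mul0r subr0 normr0 mulr0.
  have := hr h; rewrite /= add0r normrN => /(_ hh h0).
  have hn : 0 < `|h| by rewrite normr_gt0.
  rewrite -(ler_pM2l hn) -normrM [leRHS]mulrC; apply: le_trans.
  rewrite le_eqVlt -[X in X == _]normrN; apply/orP; left; apply/eqP; congr `| _ |.
  by rewrite /GRing.scale/= mulr1 (addrC h t); field.
Qed.

Lemma rder_re F t d : rder F t d -> is_derive t 1 (fun s => re (F s)) (re d).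
Proof.
move=> H; apply/is_derive_eps => e e0; have [r r0 hr] := H _ e0.
exists r => // h /hr; apply: le_trans; apply: le_trans (re_le_nm _).
by rewrite reD reD !reN reM re_cR im_cR mul0r subr0.
Qed.

Lemma rder_of_parts F t d : is_derive t 1 (fun s => re (F s)) (re d) ->
  is_derive t 1 (fun s => im (F s)) (im d) -> rder F t d.
Proof.
move=> /is_derive_eps h1 /is_derive_eps h2 e e0.
have e20 : 0 < e / 2 by rewrite divr_gt0.
have [r r0 hr] := h1 _ e20; have [r' r'0 hr'] := h2 _ e20.
exists (Num.min r r'); first by rewrite lt_min r0.
move=> h; rewrite lt_min => /andP[/hr k1 /hr' k2].
apply: le_trans (nm_le_re_im _) _.
rewrite !(reD, imD, reN, imN, reM, imM, re_cR, im_cR) !mul0r subr0 addr0; lra.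
Qed.

Lemma rder_rcont F t d : rder F t d -> rcont F t.
Proof.
move=> H e e0; have [r r0 hr] := H 1 ltr01.
have d0 := nm_ge0 d.
exists (Num.min r (e / (nm d + 2))).
  by rewrite lt_min r0 divr_gt0// ltr_wpDl.
move=> h; rewrite lt_min => /andP[/hr k1]; rewrite ltr_pdivlMr ?ltr_wpDl// => k2.
have := nmD (F (t + h) - F t - cR h * d) (cR h * d).
rewrite subrK nmM nm_cR => k3; have := normr_ge0 h; nra.
Qed.

Lemma rder_line (V : normedModType C) (f : V -> C) z v t :
  differentiable f (z + cR t *: v) ->
  rder (fun s => f (z + cR s *: v)) t ('d f (z + cR t *: v) v).
Proof.
move=> df e e0; have v0 := nm_ge0 v.
have [|r [r0 hr]] := diff_eps df (_ : 0 < e / (nm v + 1)).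
  by rewrite divr_gt0// ltr_wpDl.
exists (r / (nm v + 1)); first by rewrite divr_gt0// ltr_wpDl.
move=> h; rewrite ltr_pdivlMr ?ltr_wpDl// => hh.
have := hr (cR h *: v); rewrite nmZ nm_cR linearZ/= cRD scalerDl addrA.
have k1 : `|h| * nm v <= `|h| * (nm v + 1) by rewrite ler_wpM2l// lerDl.
move=> /(_ (le_lt_trans k1 hh)) /le_trans; apply.
by rewrite mulrAC ler_pdivrMr ?ltr_wpDl// -[leRHS]mulrA ler_wpM2l// ltW.
Qed.

Lemma rcont_line (V : normedModType C) (f : V -> C) z v t :
  {for (z + cR t *: v), continuous f} -> rcont (fun s => f (z + cR s *: v)) t.
Proof.
move=> /cont_epsP cf e e0; have v0 := nm_ge0 v.
have [r [r0 hr]] := cf _ e0.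
exists (r / (nm v + 1)); first by rewrite divr_gt0// ltr_wpDl.
move=> h; rewrite ltr_pdivlMr ?ltr_wpDl// => hh.
have := hr (cR h *: v); rewrite nmZ nm_cR cRD scalerDl addrA; apply.
by apply: le_lt_trans hh; rewrite ler_wpM2l// lerDl.
Qed.

Lemma is_derive_cont (f : R -> R) t d : is_derive t 1 f d -> {for t, continuous f}.
Proof. by move=> [/derivable1_diffP/differentiable_continuous]. Qed.

Lemma is_derive_le (f d : R -> R) a b K : a <= b ->
  (forall t, a <= t <= b -> is_derive t 1 f (d t)) ->
  (forall t, a <= t <= b -> d t <= K) -> f b - f a <= K * (b - a).
Proof.
move=> ab hf hd.
have [| |c cab ->] := @MVT_segment _ f d a b ab.
- by move=> t; rewrite in_itv /= => /andP[h1 h2]; apply: hf; rewrite !ltW.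
- apply: continuous_in_subspaceT => t; rewrite inE /= in_itv /= => h.
  exact: is_derive_cont (hf _ h).
- by rewrite ler_wpM2r ?subr_ge0// hd//; move: cab; rewrite in_itv.
Qed.

Lemma rder_re_le F (d : R -> C) a b K : a <= b ->
  (forall t, a <= t <= b -> rder F t (d t)) ->
  (forall t, a <= t <= b -> re (d t) <= K) -> re (F b - F a) <= K * (b - a).
Proof.
move=> ab hF hd; rewrite reD reN.
apply: (@is_derive_le (fun s => re (F s)) (fun s => re (d s))) => // t /hF.
exact: rder_re.
Qed.

Lemma nm_conj (z : C) : re ((conjc z : C) * z) = nm z ^+ 2.
Proof. by rewrite nm_sqr; case: z => a b; rewrite reM /= /re /im /=; ring. Qed.
Lemma nm_conjc (z : C) : nm (conjc z : C) = nm z.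
Proof. by rewrite !nm_def; case: z => a b; rewrite /re /im /= sqrrN. Qed.

(* The real function re (conj (F b - F a) * F) reduces this to the real case. *)
Lemma rder_nm_le F (d : R -> C) a b K : a <= b ->
  (forall t, a <= t <= b -> rder F t (d t)) ->
  (forall t, a <= t <= b -> nm (d t) <= K) -> nm (F b - F a) <= K * (b - a).
Proof.
move=> ab hF hd; set w := F b - F a.
have [w0|w0] := eqVneq w 0.
  rewrite w0 nm0 mulr_ge0 ?subr_ge0//.
  by apply: le_trans (hd a _); rewrite ?nm_ge0// lexx.
have := @rder_re_le (fun s => (conjc w : C) * F s) (fun s => (conjc w : C) * d s) a b
  (nm w * K) ab.
rewrite -mulrBr nm_conj expr2 -mulrA ler_pM2l ?nm_gt0//; apply.
- by move=> t /hF; apply: rderZ.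
- move=> t /hd h; apply: le_trans (ler_norm _) _; apply: le_trans (re_le_nm _) _.
  by rewrite nmM nm_conjc ler_wpM2l// nm_ge0.
Qed.

(** The difference of the two functions has derivative 0, and the mean value inequality applies with
    bound 0. Means computed from primitives thus do not depend on the primitive. *)
Lemma rder_unique F G (d : R -> C) a b : a <= b ->
  (forall t, a <= t <= b -> rder F t (d t)) ->
  (forall t, a <= t <= b -> rder G t (d t)) -> F b - F a = G b - G a.
Proof.
move=> ab hF hG; apply/eqP; rewrite -subr_eq0 -nm_eq0 eq_le nm_ge0 andbT.
rewrite (_ : _ - _ = (F b - G b) - (F a - G a)); last by ring.
rewrite -(mul0r (b - a)).
apply: (@rder_nm_le (fun s => F s - G s) (fun s => d s - d s)) => // t ht.
  by apply: rderB; [apply: hF|apply: hG].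
by rewrite subrr nm0.
Qed.

(** The fundamental theorem of calculus is used at interior points. For this reason the means over
    [0, 1] below rest on primitives over the larger interval from -1 to 2. *)
Lemma antiderivative (f : R -> R) a b : a < b ->
  (forall t, a <= t <= b -> {for t, continuous f}) ->
  exists P : R -> R, forall t, a < t < b -> is_derive t 1 P (f t).
Proof.
move=> ab cf.
have intf : (@lebesgue_measure R).-integrable `[a, b] (EFin \o f).
  apply: continuous_compact_integrable; first exact: segment_compact.
  by apply: continuous_in_subspaceT => t; rewrite inE /= in_itv /=; apply: cf.
exists (fun x => \int[@lebesgue_measure R]_(t in `[a, x]) f t)%R => t /andP[h1 h2].
have [|d1 d2] := continuous_FTC1_closed h2 intf h1; first by apply: cf; rewrite !ltW.
by apply: DeriveDef; [exact: d1|rewrite -derive1E; exact: d2].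
Qed.

Lemma rcont_re F t : rcont F t -> {for t, continuous (fun s => re (F s))}.
Proof.
move=> H; apply/cvgrPdist_lt => e e0; have [r r0 hr] := H _ e0.
apply/nbhs_normP; exists r => // s /= hs; rewrite distrC.
apply: le_lt_trans (hr (s - t) _); last by rewrite distrC.
by rewrite (addrC t) subrK; apply: le_trans (re_le_nm _); rewrite reD reN.
Qed.
Lemma rcont_im F t : rcont F t -> {for t, continuous (fun s => im (F s))}.
Proof.
move=> H; apply/cvgrPdist_lt => e e0; have [r r0 hr] := H _ e0.
apply/nbhs_normP; exists r => // s /= hs; rewrite distrC.
apply: le_lt_trans (hr (s - t) _); last by rewrite distrC.
by rewrite (addrC t) subrK; apply: le_trans (im_le_nm _); rewrite imD imN.
Qed.

Lemma rantiderivative F a b : a < b ->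
  (forall t, a <= t <= b -> rcont F t) ->
  exists P, forall t, a < t < b -> rder P t (F t).
Proof.
move=> ab cF.
have [P hP] := antiderivative ab (fun t h => rcont_re (cF t h)).
have [Q hQ] := antiderivative ab (fun t h => rcont_im (cF t h)).
exists (fun s => Complex (P s) (Q s)) => t ht.
by apply: rder_of_parts; [apply: hP|apply: hQ].
Qed.

(* The integral of F over [0, 1]; meaningless if F has no primitive there. *)
Definition cmean F : C :=
  let P := get [set P | forall t, -1 < t < 2 -> rder P t (F t)] in P 1 - P 0.

Lemma cmeanE F P : (forall t, rcont F t) ->
  (forall t, 0 <= t <= 1 -> rder P t (F t)) -> cmean F = P 1 - P 0.
Proof.
move=> cF hP; rewrite /cmean; case: xgetP => [Q _ hQ|].
  apply: (@rder_unique _ _ F) => // t /andP[h1 h2]; apply: hQ.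
  by apply/andP; split; lra.
have [|Q hQ] := @rantiderivative F (-1) 2 _ (fun t _ => cF t); first by lra.
by move=> /(_ Q); rewrite /=.
Qed.

Lemma cmean_anti F : (forall t, rcont F t) ->
  exists P, (forall t, 0 <= t <= 1 -> rder P t (F t)) /\ cmean F = P 1 - P 0.
Proof.
move=> cF.
have [|Q hQ] := @rantiderivative F (-1) 2 _ (fun t _ => cF t); first by lra.
have h t : 0 <= t <= 1 -> rder Q t (F t).
  by move=> /andP[h1 h2]; apply: hQ; apply/andP; split; lra.
by exists Q; split => //; apply: cmeanE.
Qed.

Lemma rcontB F G t : rcont F t -> rcont G t -> rcont (fun s => F s - G s) t.
Proof.
move=> hF hG e e0; have e20 : 0 < e / 2 by rewrite divr_gt0.
have [r r0 hr] := hF _ e20; have [r' r'0 hr'] := hG _ e20.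
exists (Num.min r r'); first by rewrite lt_min r0.
move=> h; rewrite lt_min => /andP[/hr h1 /hr' h2].
rewrite (_ : _ - _ = (F (t + h) - F t) - (G (t + h) - G t)); last by ring.
by apply: le_lt_trans (nmB _ _) _; lra.
Qed.

Lemma rcontZ F t k : rcont F t -> rcont (fun s => k * F s) t.
Proof.
move=> hF e e0; have k0 := nm_ge0 k.
have [|r r0 hr] := hF (e / (nm k + 1)); first by rewrite divr_gt0// ltr_wpDl.
exists r => // h /hr; rewrite ltr_pdivlMr ?ltr_wpDl// => H.
rewrite -mulrBr nmM; apply: le_lt_trans H.
by rewrite mulrC ler_wpM2l ?nm_ge0//; lra.
Qed.

Lemma cmeanB F G : (forall t, rcont F t) -> (forall t, rcont G t) ->
  cmean (fun t => F t - G t) = cmean F - cmean G.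
Proof.
move=> cF cG; have [P [hP ->]] := cmean_anti cF; have [Q [hQ ->]] := cmean_anti cG.
rewrite (@cmeanE _ (fun t => P t - Q t)); first by ring.
  by move=> t; apply: rcontB.
by move=> t ht; apply: rderB; [apply: hP|apply: hQ].
Qed.

Lemma cmeanZ F k : (forall t, rcont F t) ->
  cmean (fun t => k * F t) = k * cmean F.
Proof.
move=> cF; have [P [hP ->]] := cmean_anti cF.
rewrite (@cmeanE _ (fun t => k * P t)); first by ring.
  by move=> t; apply: rcontZ.
by move=> t ht; apply: rderZ; apply: hP.
Qed.

Lemma cmean_cst k : cmean (fun=> k) = k.
Proof.
have hk t : rcont (fun=> k) t.
  by move=> e e0; exists 1 => // h _; rewrite subrr nm0.
rewrite (@cmeanE _ (fun t => cR t * k))//.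
  by rewrite cR0 cR1 mul1r mul0r subr0.
move=> t _ e e0; exists 1 => // h _.
rewrite (_ : _ - _ = 0); first by rewrite nm0 mulr_ge0// ltW.
by rewrite cRD; ring.
Qed.

Lemma cmean_nm_le F K : (forall t, rcont F t) -> (forall t, nm (F t) <= K) ->
  nm (cmean F) <= K.
Proof.
move=> cF hK; have [P [hP ->]] := cmean_anti cF.
have := @rder_nm_le P F 0 1 K ler01 hP (fun t _ => hK t).
by rewrite subr0 mulr1.
Qed.

Lemma cmean_re_le F K : (forall t, rcont F t) -> (forall t, re (F t) <= K) ->
  re (cmean F) <= K.
Proof.
move=> cF hK; have [P [hP ->]] := cmean_anti cF.
have := @rder_re_le P F 0 1 K ler01 hP (fun t _ => hK t).
by rewrite subr0 mulr1.
Qed.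

End RealCurves.

(** * The exponential *)

Section Exponential.
Context {R : realType}.
Local Notation C := (CC R).
Implicit Types (z w : C).

Definition cexp z : C := Complex (expR (re z) * cos (im z)) (expR (re z) * sin (im z)).

Lemma cexpD z w : cexp (z + w) = cexp z * cexp w.
Proof.
apply: C_eq; rewrite ?reM ?imM /cexp /= ?(reD, imD) expRD /re /im /= ?cosD ?sinD; ring.
Qed.

Lemma nm_cexp z : nm (cexp z) = expR (re z).
Proof.
rewrite nm_def /cexp {1}/re {1}/im /=.
rewrite !exprMn -mulrDr cos2Dsin2 mulr1 sqrtr_sqr ger0_norm// expR_ge0.
Qed.

Lemma cexp_neq0 z : cexp z != 0.
Proof. by rewrite -nm_gt0 nm_cexp expR_gt0. Qed.

Lemma cexp0 : cexp 0 = 1.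
Proof. by apply: C_eq; rewrite /cexp /re /im /= ?expR0 ?cos0 ?sin0 ?mulr0 ?mulr1. Qed.

Lemma cexp_cR x : cexp (cR x) = cR (expR x).
Proof. by apply: C_eq; rewrite /cexp /re /im /= ?cos0 ?sin0 ?mulr0 ?mulr1. Qed.

Lemma cexp_2pi : cexp (cR (2 * pi) * cI) = 1.
Proof.
have -> : 2 * pi = pi *+ 2 :> R by rewrite mulr_natl.
have -> : cR (pi *+ 2) * cI = Complex 0 (pi *+ 2) :> C.
  by apply: C_eq; rewrite ?reM ?imM re_cR im_cR re_cI im_cI /re /im /=; ring.
apply: C_eq; rewrite /cexp /re /im /= expR0 mul1r ?cos2pi ?sin2pi//.
Qed.

(** Only this expansion at 0 is estimated by hand; the addition formula carries it to every point in
    [cexp_diff]. *)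
Lemma cexp_eps0 (e : R) : 0 < e -> exists2 r : R, 0 < r &
  forall h : C, nm h < r -> nm (cexp h - 1 - h) <= e * nm h.
Proof.
(* Since [nm h < e' <= 1], one gets [expR a <= 3], and the five error terms [j1] to [j5] weigh 1, 3,
   3, 1, 1 times [e' * nm h]. Their sum is 9, so 16 is a safe divisor. *)
move=> e0; set e' := Num.min (e / 16) 1.
have e'0 : 0 < e' by rewrite lt_min ltr01 andbT divr_gt0.
have e'1 : e' <= 1 by rewrite ge_min lexx orbT.
have e'e : e' <= e / 16 by rewrite ge_min lexx.
clearbody e'.
have [r1 r10 h1] := (is_derive_eps _ _ _).2 (is_derive_expR (0 : R)) _ e'0.
have [r2 r20 h2] := (is_derive_eps _ _ _).2 (is_derive_cos (0 : R)) _ e'0.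
have [r3 r30 h3] := (is_derive_eps _ _ _).2 (is_derive_sin (0 : R)) _ e'0.
exists (Num.min e' (Num.min r1 (Num.min r2 r3))); first by rewrite !lt_min e'0 r10 r20.
move=> h; rewrite !lt_min => /and4P[k0 k1 k2 k3].
have ra := re_le_nm h; have rb := im_le_nm h.
have := h1 (re h) (le_lt_trans ra k1); have := h2 (im h) (le_lt_trans rb k2).
have := h3 (im h) (le_lt_trans rb k3).
rewrite !add0r expR0 cos0 sin0 !(oppr0, mulr0, mulr1, addr0).
set a := re h in ra *; set b := im h in rb *; move=> c3 c2 c1.
have c0 : expR a <= 3.
  move: c1 (ra); rewrite !ler_norml => /andP[_ c1] /andP[_ ra'].
  have : e' * `|a| <= 1 * nm h by apply: ler_pM => //; rewrite ?ltW.
  have n1 : nm h < 1 by apply: lt_le_trans k0 _.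
  lra.
have ea0 := expR_gt0 a.
apply: le_trans (nm_le_re_im _) _.
rewrite !(reD, reN, imD, imN) re1 im1 -/a -/b.
have -> : re (cexp h) - 1 - a = (expR a - 1 - a) + expR a * (cos b - 1).
  by rewrite /cexp /re /=; rewrite -/a -/b; ring.
have -> : im (cexp h) - 0 - b = expR a * (sin b - b) + ((expR a - 1 - a) * b + a * b).
  by rewrite /cexp /im /=; rewrite -/a -/b; ring.
have n0 := nm_ge0 h.
have j1 : `|expR a - 1 - a| <= e' * nm h.
  by apply: le_trans c1 _; rewrite ler_wpM2l// ltW.
have j2 : `|expR a * (cos b - 1)| <= 3 * (e' * nm h).
  rewrite normrM ler_pM// ?(ger0_norm (ltW ea0))//.
  by apply: le_trans c2 _; rewrite ler_wpM2l// ltW.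
have j3 : `|expR a * (sin b - b)| <= 3 * (e' * nm h).
  rewrite normrM ler_pM// ?(ger0_norm (ltW ea0))//.
  by apply: le_trans c3 _; rewrite ler_wpM2l// ltW.
have j4 : `|(expR a - 1 - a) * b| <= e' * nm h * 1.
  by rewrite normrM ler_pM//; apply: (le_trans rb); apply: ltW; apply: lt_le_trans k0 _.
have j5 : `|a * b| <= e' * nm h.
  by rewrite normrM mulrC mulrC ler_pM//; apply: (le_trans ra); apply: ltW.
have i1 := ler_normD (expR a - 1 - a) (expR a * (cos b - 1)).
have i2 := ler_normD (expR a * (sin b - b)) ((expR a - 1 - a) * b + a * b).
have i3 := ler_normD ((expR a - 1 - a) * b) (a * b).
have i4 : e' * nm h <= e / 16 * nm h by rewrite ler_wpM2r.
have i5 : 0 <= e * nm h by rewrite mulr_ge0// ltW.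
lra.
Qed.

Lemma cexp_diff z : differentiable cexp z /\ forall h : C, 'd cexp z h = cexp z * h.
Proof.
have [|||d1 d2] := @eps_diff R C C cexp z (fun h => cexp z * h) (nm (cexp z)) _ _.
- by move=> k u v; rewrite mulrDr /GRing.scale/= mulrCA.
- by move=> h; rewrite nmM.
- move=> e e0; have n0 : 0 < nm (cexp z) by rewrite nm_cexp expR_gt0.
  have [|r r0 hr] := @cexp_eps0 (e / nm (cexp z)); first by rewrite divr_gt0.
  exists r; split => // h /hr.
  rewrite mulrAC ler_pdivlMr// => H.
  rewrite cexpD (_ : _ - _ = cexp z * (cexp h - 1 - h)); last by ring.
  by rewrite nmM mulrC.
- by split => // h; rewrite d2.
Qed.

Definition circ (t : R) : C := cexp (cR (2 * pi * t) * cI).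

Lemma nm_circ t : nm (circ t) = 1.
Proof. by rewrite nm_cexp reM re_cI im_cR !(mulr0, mul0r) subr0 expR0. Qed.

Lemma circ_neq0 t : circ t != 0.
Proof. exact: cexp_neq0. Qed.

Lemma circ_rder t : exists d, rder circ t d.
Proof.
exists ('d cexp (0 + cR t *: (cR (2 * pi) * cI)) (cR (2 * pi) * cI)).
have := @rder_line R C cexp 0 (cR (2 * pi) * cI) t.
have -> : (fun s => cexp (0 + cR s *: (cR (2 * pi) * cI))) = circ.
  by apply/funext => s; rewrite /circ add0r /GRing.scale/= mulrA -cRM (mulrC s).
by apply; have [] := cexp_diff (0 + cR t *: (cR (2 * pi) * cI)).
Qed.

End Exponential.

(** * Goursat's theorem *)

Section Goursat.
Context {R : realType}.
Local Notation C := (CC R).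

Lemma half_expn_lt (A d : R) : 0 < d -> exists n, A / 2 ^+ n < d.
Proof.
move=> d0; have d'0 : 0 < d / (`|A| + 1) by rewrite divr_gt0// ltr_wpDl.
have [n _ /(_ n (leqnn n)) hn] := near_infty_natSinv_expn_lt (PosNum d'0).
exists n; move: hn => /=; rewrite ltr_pdivlMr ?ltr_wpDl// => hn.
have i0 : 0 < (2 : R) ^- n by rewrite invr_gt0 exprn_gt0.
have := ler_norm A; move: hn; rewrite mul1r mulrDr mulr1; nra.
Qed.

(** The nested rectangles of Goursat's argument, for any property that passes from four quarters to
    the whole. All subrectangles keep the proportions of the first, so a single scale [q], a power
    of 1/2, describes their size. *)
Lemma bisection (P : R -> R -> R -> R -> Prop) (s t A B : R) :
  0 < A -> 0 < B ->
  (forall s t a b, 0 < a -> 0 < b -> P s t a b -> P (s + a) t a b -> P s (t + b) a b ->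
    P (s + a) (t + b) a b -> P s t (a + a) (b + b)) ->
  ~ P s t A B -> exists s' t', [/\ s <= s' <= s + A, t <= t' <= t + B &
    forall d : R, 0 < d -> exists s1 t1 q, [/\ 0 < q < d,
      s <= s1 /\ s1 + A * q <= s + A, t <= t1 /\ t1 + B * q <= t + B,
      s1 <= s' <= s1 + A * q /\ t1 <= t' <= t1 + B * q &
      ~ P s1 t1 (A * q) (B * q)]].
Proof.
move=> A0 B0 HP nP.
pose q n : R := (2 ^+ n)^-1.
have q0 n : 0 < q n by rewrite invr_gt0 exprn_gt0.
have qS n : q n = q n.+1 + q n.+1.
  by rewrite /q exprS; field; rewrite expf_eq0 pnatr_eq0 andbF.
pose ok n (p p' : R * R) := [/\ p'.1 = p.1 \/ p'.1 = p.1 + A * q n.+1,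
   p'.2 = p.2 \/ p'.2 = p.2 + B * q n.+1 & ~ P p'.1 p'.2 (A * q n.+1) (B * q n.+1)].
(* [f n] is the lower left corner of the n-th rectangle, picked among the four quarters as one where
   [P] still fails. *)
pose f := fix f n := if n is m.+1 then get [set p | ok m (f m) p] else (s, t).
have fP n : ~ P (f n).1 (f n).2 (A * q n) (B * q n) /\ ok n (f n) (f n.+1).
  have step m : ~ P (f m).1 (f m).2 (A * q m) (B * q m) -> ok m (f m) (f m.+1).
    move=> hm; rewrite /=; case: xgetP => [p _ //|none]; exfalso; apply: hm.
    rewrite (qS m) !mulrDr; apply: HP; rewrite ?mulr_gt0//; apply: contrapT => np.
    - apply: (none ((f m).1, (f m).2)); split; by [left|].
    - apply: (none ((f m).1 + A * q m.+1, (f m).2)); split; by [left|right|].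
    - apply: (none ((f m).1, (f m).2 + B * q m.+1)); split; by [left|right|].
    - apply: (none ((f m).1 + A * q m.+1, (f m).2 + B * q m.+1)); split; by [left|right|].
  elim: n => [|n [_ [h1 h2 h3]]].
    by split; [|apply: step]; rewrite /= /q expr0 invr1 !mulr1.
  by split => //; apply: step.
(* One coordinate at a time: left ends increase, right ends decrease, and the supremum of the left
   ends lies in every interval. *)
have mono (g : nat -> R) (D : R) : 0 < D ->
    (forall n, g n.+1 = g n \/ g n.+1 = g n + D * q n.+1) ->
    (forall n, g 0%N <= g n /\ g n + D * q n <= g 0%N + D) /\
    exists x, forall n, g n <= x <= g n + D * q n.
  move=> D0 hg.
  have up n k : g n <= g (n + k)%N /\ g (n + k)%N + D * q (n + k)%N <= g n + D * q n.
    elim: k => [|k [h1 h2]]; first by rewrite addn0.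
    rewrite addnS; move: h2; rewrite (qS (n + k)).
    have := q0 (n + k).+1; have := hg (n + k)%N.
    by move=> [->|->] p1 p2; split; nra.
  split.
    move=> n; have := up 0%N n; rewrite add0n /q expr0 invr1 mulr1; exact.
  have ub n m : g m <= g n + D * q n.
    have [nm|/ltnW mn] := leqP n m.
      have [_] := up n (m - n)%N; rewrite subnKC// => h.
      by have := q0 m; nra.
    have [h _] := up m (n - m)%N; rewrite subnKC// in h.
    by have := q0 n; nra.
  have hs : has_sup (range g).
    split; first by exists (g 0%N), 0%N.
    by exists (g 0%N + D * q 0%N) => _ [m _ <-]; apply: ub.
  exists (sup (range g)) => n; apply/andP; split.
    by apply: sup_upper_bound => //; exists n.
  by apply: ge_sup => [|_ [m _ <-]]; [exists (g 0%N), 0%N|apply: ub].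
have [b1 [s' hs']] := mono (fun n => (f n).1) A A0 (fun n => (fun h => let: And3 h _ _ := h.2 in h) (fP n)).
have [b2 [t' ht']] := mono (fun n => (f n).2) B B0 (fun n => (fun h => let: And3 _ h _ := h.2 in h) (fP n)).
exists s', t'; split.
- by have := hs' 0%N; rewrite /= /q expr0 invr1 mulr1.
- by have := ht' 0%N; rewrite /= /q expr0 invr1 mulr1.
- move=> d d0; have [n hn] := half_expn_lt 1 d0.
  exists (f n).1, (f n).2, (q n); split.
  + by rewrite q0 /=; move: hn; rewrite mul1r.
  + exact: b1.
  + exact: b2.
  + by split; [apply: hs'|apply: ht'].
  + by have [] := fP n.
Qed.

(** The polynomial a z + b z^2 along a line of direction [k], which will be [cI] or 1: it is the
    primitive of the affine part of [G] on the sides of a rectangle. *)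
Lemma rder_quad (a b w k : C) (t : R) :
  rder (fun t => a * (w + cR t * k) + b * (w + cR t * k) ^+ 2) t
    (k * (a + 2 * b * (w + cR t * k))).
Proof.
move=> e e0; set c := nm (b * k ^+ 2); have c0 : 0 <= c := nm_ge0 _.
exists (e / (c + 1)); first by rewrite divr_gt0// ltr_wpDl.
move=> h; rewrite ltr_pdivlMr ?ltr_wpDl// => hh.
rewrite (_ : _ - _ = cR h * cR h * (b * k ^+ 2)); last by rewrite cRD; ring.
rewrite (nmM (_ * _)) nmM nm_cR -/c -mulrA [leRHS]mulrC ler_wpM2l//.
by move: hh; rewrite mulrDr mulr1; have := normr_ge0 h; lra.
Qed.

Definition pt (s t : R) : C := cR s + cR t * cI.

Variables (G : C -> C) (V H : R -> R -> C).

(** The contour integral of [G], counterclockwise from the bottom side, with increments of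
    primitives in place of integrals: [H y] belongs to a horizontal line, [V x] to a vertical one,
    and [cI] comes from dz = i dy. *)
Definition boundary s t a b : C :=
  (H t (s + a) - H t s) + cI * (V (s + a) (t + b) - V (s + a) t)
  - (H (t + b) (s + a) - H (t + b) s) - cI * (V s (t + b) - V s t).

(* Near z' the function G is affine up to e |z - z'| and Pf is a primitive of its
   affine part, which cancels around the rectangle. *)
Lemma goursat_local s' t' (e : R) : differentiable G (pt s' t') -> 0 < e ->
  exists2 d : R, 0 < d & forall s t a b, 0 < a -> 0 < b -> a + b < d ->
  s <= s' <= s + a -> t <= t' <= t + b ->
  (forall x y, s <= x <= s + a -> t <= y <= t + b ->
    rder (V x) y (G (pt x y)) /\ rder (H y) x (G (pt x y))) ->
  nm (boundary s t a b) <= e * (a + b) ^+ 2.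
Proof.
(* Each side contributes at most [e / 2 * (a + b)] times its length, and the perimeter is
   [2 * (a + b)]. *)
move=> dG e0; have e20 : 0 < e / 2 by rewrite divr_gt0.
have [d [d0 hd]] := diff_eps dG e20; exists d => // s t a b a0 b0 abd hs ht hVH.
set z' := pt s' t' in dG hd *; set D : C := 'd G z' 1.
have dE h : 'd G z' h = h * D by rewrite -[in LHS](mulr1 h) [LHS]linearZ.
pose al := G z' - z' * D; pose be := D / 2.
pose Pf z := al * z + be * z ^+ 2.
have be2 : 2 * be = D by rewrite /be; field.
have Gb x y : s <= x <= s + a -> t <= y <= t + b ->
    nm (G (pt x y) - (al + 2 * be * pt x y)) <= e / 2 * (a + b).
  move=> hx hy; have hn : nm (pt x y - z') <= a + b.
    rewrite /z' (_ : _ - _ = cR (x - s') + cR (y - t') * cI); last first.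
      by rewrite /pt !cRB; ring.
    apply: le_trans (nmD _ _) _; rewrite nmM !nm_cR nm_cI mulr1 lerD//; rewrite ler_norml.
      by move: hx hs => /andP[? ?] /andP[? ?]; apply/andP; split; lra.
    by move: hy ht => /andP[? ?] /andP[? ?]; apply/andP; split; lra.
  have := hd (pt x y - z') (le_lt_trans hn abd); rewrite (addrC z') subrK dE => H1.
  rewrite be2 /al (_ : _ - _ = G (pt x y) - G z' - (pt x y - z') * D); last by ring.
  by apply: (le_trans H1); rewrite ler_wpM2l// ltW.
have vert x : s <= x <= s + a ->
   nm (cI * (V x (t + b) - V x t) - (Pf (pt x (t + b)) - Pf (pt x t))) <= e / 2 * (a + b) * b.
  move=> hx; have := @rder_nm_le _ (fun y => cI * V x y - Pf (pt x y))
    (fun y => cI * G (pt x y) - cI * (al + 2 * be * pt x y)) t (t + b) (e / 2 * (a + b)).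
  rewrite (_ : t + b - t = b) ?(addrC t) ?addrK//.
  rewrite (_ : cI * V x (b + t) - _ - _ =
    cI * (V x (b + t) - V x t) - (Pf (pt x (b + t)) - Pf (pt x t))); last by ring.
  apply; first by rewrite lerDr ltW.
    move=> y hy; apply: rderB; first by apply: rderZ; have [] := hVH x y hx _; rewrite // addrC.
    exact: rder_quad.
  by move=> y hy; rewrite -mulrBr nmM nm_cI mul1r; apply: Gb; rewrite // addrC.
have hori y : t <= y <= t + b ->
   nm ((H y (s + a) - H y s) - (Pf (pt (s + a) y) - Pf (pt s y))) <= e / 2 * (a + b) * a.
  move=> hy; have := @rder_nm_le _ (fun x => H y x - Pf (pt x y))
    (fun x => G (pt x y) - 1 * (al + 2 * be * pt x y)) s (s + a) (e / 2 * (a + b)).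
  rewrite (_ : s + a - s = a) ?(addrC s) ?addrK//.
  rewrite (_ : H y (a + s) - _ - _ =
    (H y (a + s) - H y s) - (Pf (pt (a + s) y) - Pf (pt s y))); last by ring.
  apply; first by rewrite lerDr ltW.
    move=> x hx; apply: rderB; first by have [] := hVH x y; rewrite // addrC.
    have := rder_quad al be (cR y * cI) 1 x; rewrite mulr1 /Pf /pt (addrC (cR x)).
    congr (rder _ _ _); apply/funext => u.
    by rewrite mulr1 (addrC (cR u)).
  by move=> x hx; rewrite mul1r; apply: Gb; rewrite // addrC.
have [i1 i2] : s <= s <= s + a /\ t <= t <= t + b by rewrite !lexx !lerDl !ltW.
have [i3 i4] : s <= s + a <= s + a /\ t <= t + b <= t + b by rewrite !lexx !lerDl !ltW.
have v1 := vert _ i1; have v2 := vert _ i3; have w1 := hori _ i2; have w2 := hori _ i4.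
rewrite /boundary; set X1 := _ - _ in w1; set X2 := _ - _ in v2; set X3 := _ - _ in w2; set X4 := _ - _ in v1.
rewrite (_ : _ - _ = (X1 + X2) - (X3 + X4)); last by rewrite /X1 /X2 /X3 /X4; ring.
have := nmB (X1 + X2) (X3 + X4); have := nmD X1 X2; have := nmD X3 X4.
by rewrite expr2; lra.
Qed.

Lemma goursat s t A B : 0 < A -> 0 < B ->
  (forall x y, s <= x <= s + A -> t <= y <= t + B -> [/\ differentiable G (pt x y),
    rder (V x) y (G (pt x y)) & rder (H y) x (G (pt x y))]) ->
  boundary s t A B = 0.
Proof.
move=> A0 B0 hyp.
(* A bound proportional to the area passes from the four quarters to the whole rectangle, which is
   what [bisection] asks for. *)
suff small (c : R) : 0 < c -> nm (boundary s t A B) <= c * (A * B).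
  apply/eqP; rewrite -nm_eq0 eq_le nm_ge0 andbT; apply/ler_addgt0Pl => c c0.
  have AB0 : 0 < A * B by rewrite mulr_gt0.
  have := small _ (divr_gt0 c0 AB0); rewrite divfK ?gt_eqF//.
  by rewrite ?addr0 ?add0r.
move=> c0; apply: contrapT.
move=> /(@bisection (fun s t a b => nm (boundary s t a b) <= c * (a * b)) _ _ _ _ A0 B0).
case.
  move=> x y a b a0 b0 h1 h2 h3 h4.
  rewrite (_ : boundary _ _ _ _ = boundary x y a b + boundary (x + a) y a b
     + (boundary x (y + b) a b + boundary (x + a) (y + b) a b)); last first.
    by rewrite /boundary !addrA; ring.
  apply: le_trans (nmD _ _) _; have := nmD (boundary x y a b) (boundary (x + a) y a b).
  have := nmD (boundary x (y + b) a b) (boundary (x + a) (y + b) a b).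
  by lra.
move=> s' [t' [hs' ht' Hd]].
have AB0 : 0 < A + B by rewrite addr_gt0.
have dG : differentiable G (pt s' t') by have [] := hyp _ _ hs' ht'.
(* With this constant the local estimate on sides [A * q] and [B * q] is exactly [c] times the area,
   against the failure preserved by bisection. *)
have [|d d0 hd] := @goursat_local s' t' (c * (A * B) / (A + B) ^+ 2) dG.
  by rewrite divr_gt0 ?mulr_gt0// exprn_gt0.
have [|s1 [t1 [q [/andP[q0 qd] [k1 k2] [k3 k4] [k5 k6]]]]] := Hd (d / (A + B)).
  by rewrite divr_gt0.
apply; move: qd; rewrite ltr_pdivlMr// => qd.
have := hd s1 t1 (A * q) (B * q).
rewrite (_ : _ * (A * q + B * q) ^+ 2 = c * (A * q * (B * q))); last first.
  by field; rewrite gt_eqF.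
apply; rewrite ?mulr_gt0//; first by rewrite -mulrDl mulrC.
move=> x y /andP[x1 x2] /andP[y1 y2].
have [||_ ? ?] := hyp x y; last by split.
  by rewrite (le_trans k1)//= (le_trans x2)// mulrC.
by rewrite (le_trans k3)//= (le_trans y2)// mulrC.
Qed.
End Goursat.

(** * The mean value property on circles *)

Section MeanValue.
Context {R : realType}.
Local Notation C := (CC R).

Lemma rcont_comp (phi : C -> C) (F : R -> C) t :
  {for F t, continuous phi} -> rcont F t -> rcont (fun s => phi (F s)) t.
Proof.
move=> /cont_epsP hphi hF e e0; have [d [d0 hd]] := hphi _ e0.
have [r r0 hr] := hF _ d0; exists r => // h /hr /hd.
by rewrite (addrC (F t)) subrK.
Qed.

Lemma rcont_circ (c k : C) t : rcont (fun s => c + k * circ s) t.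
Proof.
apply: (@rcont_comp (fun z => c + k * z) (@circ R)).
  apply/cont_epsP => e e0; have k0 := nm_ge0 k.
  exists (e / (nm k + 1)); split; first by rewrite divr_gt0// ltr_wpDl.
  move=> h; rewrite ltr_pdivlMr ?ltr_wpDl// => hh.
  rewrite (_ : _ - _ = k * h); last by ring.
  by rewrite nmM; have := nm_ge0 h; move: hh; rewrite mulrDr mulr1; lra.
by have [d /rder_rcont] := circ_rder t.
Qed.

Lemma circ1 : circ 1 = circ 0 :> C.
Proof. by rewrite /circ mulr1 mulr0 cR0 mul0r cexp0 cexp_2pi. Qed.

Lemma cexp_pt s t : cexp (cR (2 * pi) * pt s t) = cR (expR (2 * pi * s)) * circ t :> C.
Proof.
by rewrite /pt mulrDr cexpD -cRM cexp_cR mulrA -cRM.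
Qed.

(* In the coordinate s + it with z = exp(2 pi (s + it)), the horizontal sides of
   the rectangle cancel by periodicity. *)
Lemma circle_mean_radius (phi : C -> C) (rho r1 r2 : R) : 0 < r1 -> r1 < r2 -> r2 < rho ->
  (forall z, 0 < nm z < rho -> differentiable phi z) ->
  cmean (fun t => phi (cR r1 * circ t)) = cmean (fun t => phi (cR r2 * circ t)).
Proof.
move=> r10 r12 r2r dphi.
have p0 : 0 < 2 * pi :> R by rewrite mulr_gt0// pi_gt0.
pose G z := phi (cexp (cR (2 * pi) * z)).
pose lg x := ln x / (2 * pi) : R.
have lgK x : 0 < x -> expR (2 * pi * lg x) = x.
  by move=> x0; rewrite /lg mulrC divfK ?gt_eqF// lnK.
have lglt x y : 0 < x -> x < y -> lg x < lg y.
  move=> x0 xy; rewrite /lg ltr_pM2r ?invr_gt0// ltr_ln// posrE//.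
  exact: lt_trans xy.
have GE s t : G (pt s t) = phi (cR (expR (2 * pi * s)) * circ t).
  by rewrite /G cexp_pt.
(* Room to the right of [r2], because the horizontal primitives live on an open interval. On the
   left any margin will do: the exponential never reaches the centre. *)
pose r3 := (r2 + rho) / 2.
have [r23 r3r] : r2 < r3 /\ r3 < rho by rewrite /r3; split; lra.
have r20 : 0 < r2 := lt_trans r10 r12.
have dG s t : s <= lg r3 -> differentiable G (pt s t).
  move=> hs; apply: (@differentiable_comp _ _ _ _ (fun z => cexp (cR (2 * pi) * z)) phi).
    apply: (@differentiable_comp _ _ _ _ (fun z => cR (2 * pi) * z) cexp).
      exact: differentiableM.
    by have [] := cexp_diff (cR (2 * pi) * pt s t).
  apply: dphi; rewrite cexp_pt nmM nm_circ mulr1 nm_cR ger0_norm ?expR_ge0// expR_gt0/=.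
  apply: le_lt_trans r3r; rewrite -(lgK r3) ?(lt_trans r20)//.
  by rewrite ler_expR ler_pM2l.
have contV s t : s <= lg r3 -> rcont (fun y => G (pt s y)) t.
  by move=> hs; apply: (rder_rcont (rder_line (dG s t hs))).
have contH s t : s <= lg r3 -> rcont (fun x => G (pt x t)) s.
  move=> hs; have hE : (fun x => G (pt x t)) = (fun x => G (cR t * cI + cR x *: 1)).
    by apply/funext => x; rewrite /pt /GRing.scale/= mulr1 addrC.
  rewrite hE; apply: (rder_rcont (rder_line (_ : differentiable G (cR t * cI + cR s *: 1)))).
  by rewrite /GRing.scale/= mulr1 addrC; apply: dG.
have /choice[V hV] : forall s, exists Vs : R -> C, s <= lg r3 ->
    forall t, -1 < t < 2 -> rder Vs t (G (pt s t)).
  move=> s; case: (leP s (lg r3)) => hs; last by exists (fun=> 0).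
  have [||P hP] := @rantiderivative _ (fun y => G (pt s y)) (-1) 2; first by lra.
    by move=> t _; apply: contV.
  by exists P.
have /choice[H hH] : forall t, exists Ht : R -> C,
    forall s, lg r1 - 1 < s < lg r3 -> rder Ht s (G (pt s t)).
  move=> t; apply: (@rantiderivative _ (fun x => G (pt x t)) (lg r1 - 1) (lg r3)).
    by have := lglt _ _ r10 r12; have := lglt _ _ r20 r23; lra.
  by move=> s /andP[_ hs]; apply: contH.
have l12 := lglt _ _ r10 r12; have l23 := lglt _ _ r20 r23.
have := @goursat _ G V H (lg r1) 0 (lg r2 - lg r1) 1.
rewrite subr_gt0 => /(_ l12 ltr01); rewrite /boundary add0r (addrC (lg r1)) subrK => hB.
have {hB} : cI * (V (lg r2) 1 - V (lg r2) 0) = cI * (V (lg r1) 1 - V (lg r1) 0).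
  have HH : H 1 (lg r2) - H 1 (lg r1) = H 0 (lg r2) - H 0 (lg r1).
    apply: (@rder_unique _ _ _ (fun s => G (pt s 0))); first exact: ltW.
      move=> s /andP[h1 h2]; rewrite GE -circ1 -GE; apply: hH.
      by apply/andP; split; lra.
    by move=> s /andP[h1 h2]; apply: hH; apply/andP; split; lra.
  apply/eqP; rewrite -subr_eq0 -hB ?HH; first by apply/eqP; ring.
  move=> x y /andP[x1 x2] /andP[y1 y2]; split.
  - by apply: dG; lra.
  - by apply: hV; [lra|apply/andP; split; lra].
  - by apply: hH; apply/andP; split; lra.
have cI0 : (cI : C) != 0 by rewrite -nm_gt0 nm_cI.
move=> /(mulfI cI0) VE.
have cm x : 0 < x -> x < r3 -> cmean (fun t => phi (cR x * circ t)) = V (lg x) 1 - V (lg x) 0.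
  move=> x0 x3; have hx := ltW (lglt _ _ x0 x3).
  have E : (fun t => phi (cR x * circ t)) = (fun t => G (pt (lg x) t)).
    by apply/funext => t; rewrite GE lgK.
  rewrite E; apply: cmeanE => t; first exact: contV.
  by move=> /andP[t0 t1]; apply: hV => //; apply/andP; split; lra.
by rewrite !cm//; apply: lt_trans r23.
Qed.

(** The mean over a circle does not depend on the radius and tends to [phi 0] as the radius shrinks.
    Differentiability is asked off 0 because the lemma is meant for difference quotients, completed
    by hand at 0. Continuity of the integrand is returned along with the value since the rules for
    [cmean] require it. *)
Lemma mean_value (phi : C -> C) (rho r : R) : 0 < r < rho ->
  (forall z, 0 < nm z < rho -> differentiable phi z) ->
  {for 0, continuous phi} ->
  (forall t, rcont (fun t => phi (cR r * circ t)) t) /\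
  cmean (fun t => phi (cR r * circ t)) = phi 0.
Proof.
move=> /andP[r0 rr] dphi /cont_epsP cphi.
have nmc x t : 0 < x -> nm (cR x * circ t) = x.
  by move=> x0; rewrite nmM nm_circ mulr1 nm_cR ger0_norm// ltW.
have cont x t : 0 < x < rho -> rcont (fun t => phi (cR x * circ t)) t.
  move=> /andP[x0 xr]; apply: (@rcont_comp phi (fun t => cR x * circ t)).
    apply: differentiable_continuous; apply: dphi.
    by rewrite nmc// x0.
  by have := rcont_circ 0 (cR x) t; under eq_fun do rewrite add0r.
split; first by move=> t; apply: cont; rewrite r0.
apply/eqP; rewrite -subr_eq0 -nm_eq0 eq_le nm_ge0 andbT; apply/ler_addgt0Pl => e e0.
rewrite ?add0r ?addr0; have [d [d0 hd]] := cphi _ e0.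
pose x := Num.min (r / 2) (d / 2).
have x0 : 0 < x by rewrite lt_min !divr_gt0.
have xr : x < r by rewrite /x gt_min; apply/orP; left; lra.
have xd : x < d by rewrite /x gt_min; apply/orP; right; lra.
rewrite -(circle_mean_radius x0 xr rr dphi) -[X in _ - X]cmean_cst.
have xrho : 0 < x < rho by rewrite x0 (lt_trans xr).
have cc t : rcont (fun=> phi 0) t by move=> u u0; exists 1 => // h _; rewrite subrr nm0.
rewrite -cmeanB//; last by move=> t; apply: cont.
apply: cmean_nm_le => t; first by apply: rcontB => //; apply: cont.
have := hd (cR x * circ t); rewrite nmc// add0r => /(_ xd) /ltW; exact.
Qed.

End MeanValue.

(** * Holomorphic functions on balls *)

Section Holomorphic.
Context {R : realType}.
Local Notation C := (CC R).

Lemma scaleCE (a b : C) : a *: b = a * b.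
Proof. by []. Qed.

Section NearDiff.
Context {V W : normedModType C}.
Implicit Types f g : V -> W.

Lemma diff_bounded f x : differentiable f x ->
  exists2 K : R, 0 <= K & forall h, nm ('d f x h) <= K * nm h.
Proof.
move=> df; have cL : continuous ('d f x) by exact: diff_continuous.
have /cont_epsP /(_ 1 ltr01) [d [d0 hd]] : {for 0, continuous ('d f x)} by exact: cL.
exists (2 / d) => [|h]; first by rewrite divr_ge0// ltW.
have [->|h0] := eqVneq h 0; first by rewrite linear0 !nm0 mulr0.
have n0 : 0 < nm h by rewrite nm_gt0.
pose k := d / 2 / nm h; have k0 : 0 < k by rewrite !divr_gt0.
have := hd (cR k *: h).
rewrite nmZ nm_cR gtr0_norm// /k divfK ?gt_eqF// add0r linear0 subr0 linearZ/= nmZ nm_cR gtr0_norm//.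
have -> : d / 2 < d by lra.
move=> /(_ isT); rewrite -ltr_pdivlMl// => /ltW/le_trans; apply.
rewrite mulr1 le_eqVlt; apply/orP; left; apply/eqP; field.
by rewrite !gt_eqF.
Qed.

Lemma near_diff f g x (d : R) : 0 < d -> (forall h, nm h < d -> f (x + h) = g (x + h)) ->
  differentiable f x -> differentiable g x /\ 'd g x = 'd f x :> (V -> W).
Proof.
move=> d0 fg df; have [K _ hK] := diff_bounded df.
apply: (eps_diff (K := K)) => //; first by move=> k u v; rewrite linearP.
move=> e e0; have [r [r0 hr]] := diff_eps df e0.
exists (Num.min d r); split; first by rewrite lt_min d0.
move=> h; rewrite lt_min => /andP[hd /hr]; rewrite fg//.
by have := fg 0; rewrite addr0 nm0 => ->.
Qed.

End NearDiff.

Section Mean.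
Context {V : normedModType C}.
Implicit Types (f g : V -> C) (c z v h : V).

Lemma diff_linear f z k u v : 'd f z (k *: u + v) = k * 'd f z u + 'd f z v.
Proof. by rewrite linearP. Qed.

Definition hol f c (rho : R) := forall z, nm (z - c) < rho -> differentiable f z.

Lemma hol_ball f c z (rho r : R) : nm (z - c) + r <= rho -> hol f c rho -> hol f z r.
Proof.
move=> hr hf w hw; apply: hf; rewrite (_ : w - c = (w - z) + (z - c)); last first.
  by rewrite addrA subrK.
by apply: le_lt_trans (nmD _ _) _; lra.
Qed.

(** The mean value property for the quotient (f (z + x v) - f z) / x, completed by ['d f z v] at x =
    0. A derivative becomes a mean of values of [f], with no limit left in it. *)
Lemma diff_mean f z v (rho r : R) : 0 < r -> r * nm v < rho -> hol f z rho ->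
  (forall t, rcont (fun t => (f (z + (cR r * circ t) *: v) - f z) / (cR r * circ t)) t) /\
  'd f z v = cmean (fun t => (f (z + (cR r * circ t) *: v) - f z) / (cR r * circ t)).
Proof.
move=> r0 rv hf; have v0 := nm_ge0 v.
have hd0 : differentiable f z by apply: hf; rewrite subrr nm0; have := mulr_ge0 (ltW r0) v0; lra.
pose phi (x : C) := if x == 0 then 'd f z v else (f (z + x *: v) - f z) / x.
(* Chosen so that [(r + de) * nm v < rho]: the disc on which [phi] is studied slightly exceeds the
   circle of radius [r]. The added 1 covers [v = 0]. *)
pose de := (rho - r * nm v) / (nm v + 1).
have v1 : 0 < nm v + 1 by rewrite ltr_wpDl.
have de0 : 0 < de by rewrite divr_gt0// subr_gt0.
have deE : de * (nm v + 1) = rho - r * nm v by rewrite divfK// gt_eqF.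
have dphi x : 0 < nm x < r + de -> differentiable phi x.
  move=> /andP[x0 xr]; have xn0 : x != 0 by rewrite -nm_gt0.
  have dq : differentiable (fun y : C => (f (z + y *: v) - f z) / y) x.
    have d1 : differentiable (fun y : C => f (z + y *: v) - f z) x.
      apply: differentiableB; last exact: differentiable_cst.
      apply: (@differentiable_comp _ _ _ _ (fun y : C => z + y *: v) f).
        apply: differentiableD; first exact: differentiable_cst.
        exact: differentiableZl.
      apply: hf; rewrite addrAC subrr add0r nmZ; nra.
    by apply: differentiableM; [exact: d1|exact: differentiable_Rinv].
  apply: (near_diff (d := nm x) _ _ dq).1 => // h hh; rewrite /phi.
  case: eqP => // /eqP; rewrite addr_eq0 => /eqP xh.
  by move: hh; rewrite xh nmN ltxx.
have cphi : {for 0, continuous phi}.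
  apply/cont_epsP => e e0.
  have [|d [d0 hd]] := diff_eps hd0 (_ : 0 < e / 2 / (nm v + 1)).
    by rewrite !divr_gt0.
  exists (d / (nm v + 1)); split; first by rewrite divr_gt0.
  move=> h; rewrite add0r /phi eqxx; case: eqP => [|/eqP h0]; first by rewrite subrr nm0.
  rewrite ltr_pdivlMr// => hh.
  have n0 : 0 < nm h by rewrite nm_gt0.
  have := hd (h *: v); rewrite nmZ linearZ/=.
  have -> : nm h * nm v < d by nra.
  move=> /(_ isT) hhd.
  rewrite (_ : _ - _ = (f (z + h *: v) - f z - h *: 'd f z v) / h); last first.
    by rewrite /GRing.scale/=; field.
  rewrite nmM nmV ltr_pdivrMr//; apply: le_lt_trans hhd _.
  rewrite mulrAC ltr_pdivrMr//.
  have := mulr_ge0 (ltW e0) v0; have := mulr_gt0 e0 n0; nra.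
have [|k1 k2] := @mean_value _ phi (r + de) r _ dphi cphi.
  by rewrite r0/=; lra.
have E : (fun t => phi (cR r * circ t)) =
    (fun t => (f (z + (cR r * circ t) *: v) - f z) / (cR r * circ t)).
  apply/funext => t; rewrite /phi mulf_eq0 (negbTE (circ_neq0 t)) orbF cR_eq0.
  by rewrite gt_eqF.
by rewrite -E; split => //; rewrite k2 /phi eqxx.
Qed.

Lemma seg_le f z h (K : R) :
  (forall t : R, 0 <= t <= 1 -> differentiable f (z + cR t *: h)) ->
  (forall t : R, 0 <= t <= 1 -> nm ('d f (z + cR t *: h) h) <= K) ->
  nm (f (z + h) - f z) <= K.
Proof.
move=> df hK; have := @rder_nm_le _ (fun t => f (z + cR t *: h)) (fun t => 'd f (z + cR t *: h) h) 0 1 K ler01.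
rewrite cR0 cR1 scale0r addr0 scale1r subr0 mulr1; apply => // t ht.
by apply: rder_line; apply: df.
Qed.

Lemma cauchy_estimate f z v (rho M : R) : 0 < rho -> hol f z rho ->
  (forall w, nm (w - z) < rho -> nm (f w) <= M) ->
  nm ('d f z v) <= 4 * M / rho * nm v.
Proof.
move=> rho0 hf hM; have [->|vn0] := eqVneq v 0; first by rewrite linear0 !nm0 mulr0.
have v0 : 0 < nm v by rewrite nm_gt0.
(* The circle stays at distance [rho / 2] from [z]; the quotients are at most [2 * M / r], which is
   the announced [4 * M / rho * nm v]. *)
pose r := rho / 2 / nm v; have r0 : 0 < r by rewrite !divr_gt0.
have rv : r * nm v = rho / 2 by rewrite divfK// gt_eqF.
have [|k1 ->] := diff_mean (v := v) r0 _ hf; first by rewrite rv; lra.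
have -> : 4 * M / rho * nm v = 2 * M / r by rewrite /r; field; rewrite !gt_eqF.
apply: cmean_nm_le => // t; rewrite nmM nmV nmM nm_circ mulr1 nm_cR gtr0_norm//.
rewrite ler_pM2r ?invr_gt0//; apply: le_trans (nmB _ _) _.
have m1 : nm (f (z + (cR r * circ t) *: v)) <= M.
  by apply: hM; rewrite addrAC subrr add0r nmZ nmM nm_circ mulr1 nm_cR gtr0_norm// rv; lra.
have m2 : nm (f z) <= M by apply: hM; rewrite subrr nm0.
lra.
Qed.

Section Bounded.
Context f c (rho M : R) (rho_gt0 : 0 < rho) (hf : hol f c rho)
  (hM : forall w, nm (w - c) < rho -> nm (f w) <= M).

(** [K1] is the Cauchy constant 4 M / (rho / 2) at points that are centres of balls of radius
    [rho / 2] inside the given one. [K2] is 2 K1 / (rho / 8), where [rho / 8] is the displacement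
    used in [diff_lip]. *)
Let K1 := 8 * M / rho.
Let K2 := 128 * M / rho ^+ 2.

Lemma ball_seg (z h : V) (t r : R) : nm (z - c) < r -> nm (z + h - c) < r ->
  0 <= t <= 1 -> nm (z + cR t *: h - c) < r.
Proof.
move=> h1 h2 /andP[t0 t1].
rewrite (_ : _ - _ = cR (1 - t) *: (z - c) + cR t *: (z + h - c)); last first.
  rewrite (addrAC z h) [cR t *: (_ - _ + _)]scalerDr cRB cR1 scalerBl scale1r.
  by rewrite addrA subrK addrAC.
apply: le_lt_trans (nmD _ _) _; rewrite !nmZ !nm_cR !ger0_norm ?subr_ge0//.
have [t1'|t1'] := eqVneq t 1; first by rewrite t1' subrr mul0r add0r mul1r.
have : t < 1 by rewrite lt_neqAle t1'.
nra.
Qed.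

Lemma M_ge0 : 0 <= M.
Proof. by apply: le_trans (hM (w := c) _); rewrite ?nm_ge0// subrr nm0. Qed.

Lemma diff_bound z v : nm (z - c) < rho / 2 -> nm ('d f z v) <= K1 * nm v.
Proof.
have rho0 := rho_gt0.
move=> hz; have := @cauchy_estimate f z v (rho / 2) M.
rewrite (_ : 4 * M / (rho / 2) = K1); last by rewrite /K1; field; rewrite gt_eqF.
apply; first by rewrite divr_gt0.
  by apply: hol_ball hf; lra.
move=> w hw; apply: hM; rewrite (_ : w - c = (w - z) + (z - c)); last first.
  by rewrite addrA subrK.
by apply: le_lt_trans (nmD _ _) _; lra.
Qed.

Lemma lip_bound z h : nm (z - c) < rho / 2 -> nm (z + h - c) < rho / 2 ->
  nm (f (z + h) - f z) <= K1 * nm h.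
Proof.
have rho0 := rho_gt0.
move=> hz hzh; apply: seg_le => t ht; have hb := ball_seg hz hzh ht.
  by apply: hf; lra.
exact: diff_bound.
Qed.

(** By the mean formula the difference of the two differentials is a mean of second differences of
    [f]. Grouped as two increments by [h], they are controlled by [lip_bound], so no second
    derivative has to exist yet. *)
Lemma diff_lip z h v : nm (z - c) < rho / 4 -> nm (z + h - c) < rho / 4 ->
  nm ('d f (z + h) v - 'd f z v) <= K2 * nm h * nm v.
Proof.
have rho0 := rho_gt0.
move=> hz hzh; have [->|vn0] := eqVneq v 0; first by rewrite !linear0 addr0 !nm0 mulr0.
have v0 : 0 < nm v by rewrite nm_gt0.
pose r := rho / 8 / nm v; have r0 : 0 < r by rewrite !divr_gt0.
have rv : r * nm v = rho / 8 by rewrite divfK// gt_eqF.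
have hr : r * nm v < rho / 4 by rewrite rv; lra.
have [|k1 ->] := @diff_mean f (z + h) v _ _ r0 hr _.
  by apply: hol_ball hf; lra.
have [|k2 ->] := @diff_mean f z v _ _ r0 hr _.
  by apply: hol_ball hf; lra.
rewrite -cmeanB//; apply: cmean_nm_le => [t|t]; first exact: rcontB.
set x := cR r * circ t; have xn : nm x = r by rewrite nmM nm_circ mulr1 nm_cR gtr0_norm.
have x0 : x != 0 by rewrite -nm_gt0 xn.
rewrite -mulrBl nmM nmV xn ler_pdivrMr//.
have -> : K2 * nm h * nm v * r = 2 * (K1 * nm h).
  by rewrite -mulrA [nm v * r]mulrC rv /K2 /K1; field; rewrite gt_eqF.
rewrite (_ : _ - _ = (f (z + x *: v + h) - f (z + x *: v)) - (f (z + h) - f z)); last first.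
  by rewrite (addrAC z); ring.
apply: le_trans (nmB _ _) _; rewrite mulr_natl mulr2n; apply: lerD; apply: lip_bound; try lra.
- rewrite addrAC; apply: le_lt_trans (nmD _ _) _; rewrite nmZ xn rv; lra.
- rewrite (addrAC z) (addrAC (z + h)); apply: le_lt_trans (nmD _ _) _; rewrite nmZ xn rv; lra.
Qed.

Lemma K2_ge0 : 0 <= K2.
Proof. by rewrite /K2 divr_ge0 ?mulr_ge0 ?M_ge0 ?exprn_ge0// ltW. Qed.
Lemma K1_ge0 : 0 <= K1.
Proof. by rewrite /K1 divr_ge0 ?mulr_ge0 ?M_ge0// ltW. Qed.

(** Along the segment, f (z + t h) - t 'd f z h has as derivative a difference of two differentials
    in the direction [h], which [diff_lip] bounds. *)
Lemma taylor2 z h : nm (z - c) < rho / 4 -> nm (z + h - c) < rho / 4 ->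
  nm (f (z + h) - f z - 'd f z h) <= K2 * nm h * nm h.
Proof.
have rho0 := rho_gt0.
move=> hz hzh; have := @rder_nm_le _ (fun t => f (z + cR t *: h) - 'd f z (0 + cR t *: h))
   (fun t => 'd f (z + cR t *: h) h - 'd f z h) 0 1 (K2 * nm h * nm h) ler01.
rewrite cR0 cR1 !(scale0r, addr0, add0r, scale1r) linear0 !(oppr0, addr0) mulr1.
rewrite addrAC; apply => t ht; have hb := ball_seg hz hzh ht.
  apply: rderB; first by apply: rder_line; apply: hf; lra.
  have dd : differentiable ('d f z) (0 + cR t *: h).
    apply: linear_differentiable; apply: diff_continuous; apply: hf; lra.
  have := rder_line dd; rewrite (diff_lin _ _)//.
  by apply: diff_continuous; apply: hf; lra.
apply: le_trans (diff_lip _ _ _) _ => //.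
rewrite ler_wpM2r ?nm_ge0// ler_wpM2l ?K2_ge0// nmZ nm_cR.
by case/andP: ht => t0 t1; rewrite ger0_norm// ler_piMl// nm_ge0.
Qed.

(** Differentiation under the mean. The mean formulas at [z + h] and at [z], minus the candidate
    [L h], combine into a mean of two Taylor remainders of [f], at z + x v and at z, divided by x;
    by [taylor2] this is quadratic in [h]. *)
Lemma diff_diff_mean z v (r : R) : nm (z - c) < rho / 8 -> 0 < r -> r * nm v < rho / 16 ->
  differentiable (fun w => 'd f w v) z /\ forall h, 'd (fun w => 'd f w v) z h =
  cmean (fun t => ('d f (z + (cR r * circ t) *: v) h - 'd f z h) / (cR r * circ t)).
Proof.
have rho0 := rho_gt0.
move=> hz r0 rv.
pose L h := cmean (fun t => ('d f (z + (cR r * circ t) *: v) h - 'd f z h) / (cR r * circ t)).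
suff [] : differentiable (fun w => 'd f w v) z /\ 'd (fun w => 'd f w v) z = L :> (V -> C).
  by move=> d1 d2; split=> [|h]; [exact: d1|exact: (congr1 (fun F => F h) d2)].
have xn t : nm (cR r * circ t) = r by rewrite nmM nm_circ mulr1 nm_cR gtr0_norm.
have x0 t : cR r * circ t != 0 by rewrite -nm_gt0 xn.
have nzt t : nm (z + (cR r * circ t) *: v - c) < rho / 4.
  by rewrite addrAC; apply: le_lt_trans (nmD _ _) _; rewrite nmZ xn; lra.
have contL h t : rcont (fun t => ('d f (z + (cR r * circ t) *: v) h - 'd f z h) / (cR r * circ t)) t.
  have ci t' : rcont (fun t => (cR r * circ t)^-1) t'.
    apply: (@rcont_comp _ (fun x : C => x^-1) (fun t => cR r * circ t)).
      by apply: differentiable_continuous; apply: differentiable_Rinv.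
    by have := rcont_circ 0 (cR r) t'; under eq_fun do rewrite add0r.
  have cd t' : rcont (fun t => 'd f (z + (cR r * circ t) *: v) h - 'd f z h) t'.
    move=> e e0; have := rcont_circ 0 (cR r) t'; under eq_fun do rewrite add0r.
    have kk : 0 <= K2 * nm v * nm h by apply: mulr_ge0 (nm_ge0 _); apply: mulr_ge0 (nm_ge0 _); exact: K2_ge0.
    move=> /(_ (e / (K2 * nm v * nm h + 1)))[|d d0 hd].
      by rewrite divr_gt0// ltr_wpDl.
    exists d => // s /hd; rewrite ltr_pdivlMr ?ltr_wpDl// => hs.
    set x := cR r * circ t' in hs *; set y := cR r * circ (t' + s) in hs *.
    have yE : z + x *: v + (y - x) *: v = z + y *: v.
      by rewrite -addrA -scalerDl (addrC x) subrK.
    rewrite (_ : _ - _ = 'd f (z + x *: v + (y - x) *: v) h - 'd f (z + x *: v) h); last first.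
      by rewrite yE; ring.
    apply: le_lt_trans (diff_lip _ _ _) _; first exact: nzt.
      by rewrite yE; exact: nzt.
    rewrite nmZ; have := nm_ge0 (y - x); nra.
  move=> e e0.
  set F := fun t => 'd f (z + (cR r * circ t) *: v) h - 'd f z h in cd *.
  have FB : nm (F t) <= 2 * (K1 * nm h).
    apply: le_trans (nmB _ _) _; have p := nzt t.
    have i1 : nm ('d f z h) <= K1 * nm h by apply: diff_bound; lra.
    have i2 : nm ('d f (z + (cR r * circ t) *: v) h) <= K1 * nm h by apply: diff_bound; lra.
    lra.
  have [r1 r10 h1] := cd t (e * r / 3) ltac:(by rewrite divr_gt0// mulr_gt0).
  have KK : 0 < 2 * (K1 * nm h) + 1.
    rewrite ltr_wpDl//; apply: mulr_ge0 => //; apply: mulr_ge0 (nm_ge0 _).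
    exact: K1_ge0.
  have [|r2 r20 h2] := ci t (e / 3 / (2 * (K1 * nm h) + 1)).
    by rewrite !divr_gt0.
  exists (Num.min r1 r2); first by rewrite lt_min r10.
  move=> s; rewrite lt_min => /andP[/h1 k1 /h2 k2].
  rewrite -/(F t) -/(F (t + s)).
  rewrite (_ : _ - _ = (F (t + s) - F t) * (cR r * circ (t + s))^-1 +
     F t * ((cR r * circ (t + s))^-1 - (cR r * circ t)^-1)); last by ring.
  apply: le_lt_trans (nmD _ _) _; rewrite !nmM nmV xn.
  have j1 : nm (F (t + s) - F t) / r <= e / 3 by rewrite ler_pdivrMr// mulrAC ltW.
  have j2 : nm (F t) * nm ((cR r * circ (t + s))^-1 - (cR r * circ t)^-1) <= e / 3.
    move: k2; rewrite ltr_pdivlMr// => k2.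
    have := nm_ge0 ((cR r * circ (t + s))^-1 - (cR r * circ t)^-1); nra.
  lra.
apply: (@eps_diff _ _ _ _ _ L (2 * K1 / r)).
(* The sum is treated as a difference with a factor -1, so that [cmeanB] and [cmeanZ] give
   linearity. *)
- move=> k u w; have H := cmeanB (fun t => rcontZ k (contL u t))
    (fun t => rcontZ (-1) (contL w t)).
  rewrite (cmeanZ k (contL u)) (cmeanZ (-1) (contL w)) mulN1r opprK in H.
  apply: etrans H; congr cmean; apply/funext => t.
  by rewrite !diff_linear; ring.
- move=> h; apply: cmean_nm_le => // t; rewrite nmM nmV xn ler_pdivrMr// mulrAC divfK ?gt_eqF//.
  apply: le_trans (nmB _ _) _.
  have p := nzt t.
  have i1 : nm ('d f z h) <= K1 * nm h by apply: diff_bound; lra.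
  have i2 : nm ('d f (z + (cR r * circ t) *: v) h) <= K1 * nm h by apply: diff_bound; lra.
  lra.
(* Two Taylor remainders with constant [K2], each divided by a number of norm [r]. *)
- move=> e e0; pose K := 2 * K2 / r; have K0 : 0 <= K.
    by apply: divr_ge0 (ltW r0); apply: mulr_ge0 => //; exact: K2_ge0.
  exists (Num.min (rho / 16) (e / (K + 1))); split; first by rewrite lt_min !divr_gt0// ltr_wpDl.
  move=> h; rewrite lt_min => /andP[h1]; rewrite ltr_pdivlMr ?ltr_wpDl// => h2.
  have hzh : nm (z + h - c) < rho / 4.
    by rewrite addrAC; apply: le_lt_trans (nmD _ _) _; lra.
  have rv' : r * nm v < rho / 2 by lra.
  have [|k1 ->] := @diff_mean f (z + h) v _ _ r0 rv' _.
    by apply: hol_ball hf; lra.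
  have [|k2 ->] := @diff_mean f z v _ _ r0 rv' _.
    by apply: hol_ball hf; lra.
  rewrite -cmeanB// -cmeanB//; last by move=> t; apply: rcontB.
  apply: le_trans (_ : K * nm h * nm h <= _); last first.
    by rewrite ler_wpM2r ?nm_ge0//; move: h2; rewrite mulrDr mulr1 mulrC; have := nm_ge0 h; lra.
  apply: cmean_nm_le => t; first by apply: rcontB => //; apply: rcontB.
  set x := cR r * circ t.
  have -> : (f (z + h + x *: v) - f (z + h)) / x - (f (z + x *: v) - f z) / x
      - ('d f (z + x *: v) h - 'd f z h) / x =
     ((f (z + x *: v + h) - f (z + x *: v) - 'd f (z + x *: v) h) - (f (z + h) - f z - 'd f z h)) / x.
    by rewrite (addrAC z h); ring.
  rewrite nmM nmV xn ler_pdivrMr//.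
  have -> : K * nm h * nm h * r = K2 * nm h * nm h + K2 * nm h * nm h by rewrite /K; field; rewrite gt_eqF.
  apply: le_trans (nmB _ _) _; apply: lerD; apply: taylor2 => //; try lra; first exact: nzt.
  rewrite (addrAC z) (addrAC (z + h)); apply: le_lt_trans (nmD _ _) _; rewrite nmZ xn.
  by rewrite (addrAC z h); have := nmD (z - c) h; lra.
Qed.

End Bounded.

Lemma hol_bounded f c (rho : R) : 0 < rho -> hol f c rho -> exists r M : R,
  [/\ 0 < r <= rho, hol f c r & forall w, nm (w - c) < r -> nm (f w) <= M].
Proof.
move=> rho0 hf; have /cont_epsP cf : {for c, continuous f}.
  by apply: differentiable_continuous; apply: hf; rewrite subrr nm0.
have [d [d0 hd]] := cf 1 ltr01.
exists (Num.min rho d), (nm (f c) + 1); split.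
- by rewrite lt_min rho0 d0 ge_min lexx.
- by move=> z; rewrite lt_min => /andP[hz _]; apply: hf.
- move=> w; rewrite lt_min => /andP[_ /hd]; rewrite (addrC c) subrK => h.
  have := nmD (f w - f c) (f c); rewrite subrK; lra.
Qed.

Theorem hol_derive f c (rho : R) v : 0 < rho -> hol f c rho ->
  differentiable (fun w => 'd f w v) c.
Proof.
move=> rho0 /(hol_bounded rho0)[r [M [/andP[r0 _] hf hM]]].
have v1 : 0 < nm v + 1 by rewrite ltr_wpDl// nm_ge0.
have [] := @diff_diff_mean f c r M r0 hf hM c v (r / 32 / (nm v + 1)) => //.
- by rewrite subrr nm0 divr_gt0.
- by rewrite !divr_gt0.
- by rewrite mulrAC ltr_pdivrMr//; have := nm_ge0 v; nra.
Qed.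

(** Both sides equal the mean of ('d f (c + x u) v - 'd f c v) / x over one circle: the left one by
    differentiating the mean formula for ['d f w u], the right one by the mean formula for the
    function ['d f w v] in the direction [u]. *)
Theorem hol_derive_sym f c (rho : R) u v : 0 < rho -> hol f c rho ->
  'd (fun w => 'd f w u) c v = 'd (fun w => 'd f w v) c u.
Proof.
move=> rho0 hf0; have [r [M [/andP[r0 rrho] hf hM]]] := hol_bounded rho0 hf0.
have v1 : 0 < nm u + 1 by rewrite ltr_wpDl// nm_ge0.
have u0 := nm_ge0 u.
pose s := r / 32 / (nm u + 1).
have s0 : 0 < s by rewrite !divr_gt0.
have su : s * nm u < r / 16 by rewrite mulrAC ltr_pdivrMr//; nra.
have cc : nm (c - c) < r / 8 by rewrite subrr nm0 divr_gt0.
have [_ /(_ v) H1] := diff_diff_mean r0 hf hM cc s0 su; apply: etrans H1 _.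
have hg : hol (fun w => 'd f w v) c (r / 2).
  move=> z hz; apply: (@hol_derive f z (r / 2)); first by rewrite divr_gt0.
  by apply: hol_ball hf; lra.
have [|_ H2] := @diff_mean (fun w => 'd f w v) c u (r / 2) s s0 _ hg; first by lra.
by apply: esym; apply: etrans H2 _.
Qed.

End Mean.
End Holomorphic.

(** * The identity theorem *)

Section Identity.
Context {R : realType}.
Local Notation C := (CC R).

Lemma re_mean_le (q : C -> C) (rho r S : R) : 0 < r < rho -> hol q 0 rho ->
  (forall t, re (q (cR r * circ t)) <= S) -> re (q 0) <= S.
Proof.
move=> rr hq hS; have [||c <-] := @mean_value _ q rho r rr.
- by move=> z /andP[_ hz]; apply: hq; rewrite subr0.
- apply: differentiable_continuous; apply: hq; rewrite subrr nm0.
  by case/andP: rr; apply: lt_trans.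
- exact: cmean_re_le.
Qed.

(** Multiplication by [k] turns the norm of a holomorphic function at one point into the real part
    of a holomorphic function, for which the mean value property gives inequalities. *)
Lemma conj_phase (w : C) : exists2 k : C, nm k <= 1 & re (k * w) = nm w.
Proof.
have [->|w0] := eqVneq w 0; first by exists 1; rewrite ?nm1// mulr0 nm0.
have n0 : 0 < nm w by rewrite nm_gt0.
exists (cR (nm w)^-1 * conjc w).
  by rewrite nmM nm_conjc nm_cR gtr0_norm ?invr_gt0// mulVf// gt_eqF.
rewrite -mulrA reM re_cR im_cR mul0r subr0 nm_conj expr2 mulrA mulVf ?mul1r//.
by rewrite gt_eqF.
Qed.

(* Adding e |z|^2 makes the mean value inequality strict, so that the
   supremum of nm (psi z) + e |z|^2 can only be approached in the annulus. *)
Lemma max_principle (psi : C -> C) (rho rho' B N : R) : 0 < rho' < rho ->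
  hol psi 0 rho -> (forall z, nm z < rho -> nm (psi z) <= N) ->
  (forall z, rho' <= nm z < rho -> nm (psi z) <= B) ->
  forall z, nm z < rho -> nm (psi z) <= B.
Proof.
move=> /andP[r'0 r'r] hpsi hN hB z0 hz0; apply/ler_addgt0Pl => e' e'0.
have rho0 : 0 < rho := lt_trans r'0 r'r.
pose e := e' / rho ^+ 2; have e0 : 0 < e by rewrite divr_gt0// exprn_gt0.
have eE : e * rho ^+ 2 = e' by rewrite divfK// gt_eqF// exprn_gt0.
pose g z := nm (psi z) + e * nm z ^+ 2.
pose de := (rho - rho') / 2; have de0 : 0 < de by rewrite divr_gt0// subr_gt0.
have sqle z : nm z < rho -> e * nm z ^+ 2 <= e'.
  by move=> hz; rewrite -eE ler_pM2l// ler_pXn2r ?nnegrE ?nm_ge0// ltW.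
have step S : (forall z, nm z < rho -> g z <= S) ->
    forall z, nm z < rho' -> g z + e * de ^+ 2 <= S.
  move=> hS z hz; have [k k1 kE] := conj_phase (psi z).
  (* On the circle [nm x = de] the real part of the second summand is e |z + x|^2, whereas at x = 0
     it is e |z|^2 + e de^2. The term e de^2 is the strict gain. *)
  pose q x := k * psi (z + x) + cR e * (cR (nm z ^+ 2 + de ^+ 2) + 2 * (conjc z : C) * x).
  have hq : hol q 0 (rho - rho').
    move=> x; rewrite subr0 => hx.
    have d1 : differentiable (fun x : C => psi (z + x)) x.
      apply: (@differentiable_comp _ _ _ _ (fun y : C => z + y) psi).
        by apply: differentiableD; [exact: differentiable_cst|exact: ex_diff].
      by apply: hpsi; rewrite subr0; apply: le_lt_trans (nmD _ _) _; lra.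
    apply: differentiableD; first by apply: differentiableM => //; exact: differentiable_cst.
    apply: differentiableM; first exact: differentiable_cst.
    apply: differentiableD; first exact: differentiable_cst.
    by apply: differentiableM; [exact: differentiable_cst|exact: ex_diff].
  have := @re_mean_le q (rho - rho') de S _ hq.
  have -> : re (q 0) = g z + e * de ^+ 2.
    rewrite /q mulr0 !addr0 -cRM reD kE re_cR /g; ring.
  apply; first by rewrite de0 /de; lra.
  move=> t; set x := cR de * circ t.
  have xn : nm x = de by rewrite nmM nm_circ mulr1 nm_cR gtr0_norm.
  apply: le_trans (hS (z + x) _); last by apply: le_lt_trans (nmD _ _) _; rewrite xn /de; lra.
  have -> : re (q x) = re (k * psi (z + x)) + e * nm (z + x) ^+ 2.
    rewrite /q reD; congr (_ + _); rewrite -xn !nm_sqr.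
    rewrite !(reM, imM, reD, imD, re_cR, im_cR, re1, im1) /=.
    by case: (z) => a b; rewrite /re /im /=; ring.
  rewrite lerD2r; apply: le_trans (ler_norm _) _; apply: le_trans (re_le_nm _) _.
  by rewrite nmM -[leRHS]mul1r ler_wpM2r ?nm_ge0.
pose A := [set g z | z in [set z : C | nm z < rho]].
have hA : has_sup A.
  split; first by exists (g 0), 0 => //=; rewrite nm0.
  exists (N + e') => _ [z /= hz <-]; apply: lerD; [exact: hN|exact: sqle].
have supA z : nm z < rho -> g z <= sup A.
  by move=> hz; apply: sup_upper_bound => //; exists z.
suff : sup A <= B + e'.
  move=> h; apply: le_trans (_ : g z0 <= _); first by rewrite lerDl mulr_ge0 ?exprn_ge0 ?nm_ge0// ltW.
  by apply: le_trans (supA _ hz0) _; rewrite addrC.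
rewrite leNgt; apply/negP => hlt.
have [] := @sup_adherent _ A (Num.min (e * de ^+ 2) (sup A - (B + e'))) _ hA.
  by rewrite lt_min subr_gt0 hlt andbT mulr_gt0// exprn_gt0.
move=> _ [z /= hz <-]; case: (ltP (nm z) rho') => hzr.
  have := step _ supA _ hzr; rewrite ltrBlDr => h1 h2.
  have : Num.min (e * de ^+ 2) (sup A - (B + e')) <= e * de ^+ 2 by rewrite ge_min lexx.
  lra.
have h1 : g z <= B + e' by apply: lerD; [apply: hB; rewrite hzr|exact: sqle].
have : Num.min (e * de ^+ 2) (sup A - (B + e')) <= sup A - (B + e') by rewrite ge_min lexx orbT.
lra.
Qed.

Lemma geometric_small (q M x : R) : 0 <= q < 1 -> (forall k : nat, x <= M * q ^+ k) -> x <= 0.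
Proof.
move=> /andP[q0 q1] hx.
have c : (fun k => M * q ^+ k) @ \oo --> M * 0.
  by apply: cvgMr; apply: cvg_expr; rewrite ger0_norm.
rewrite -(mulr0 M) -(cvg_lim (@norm_hausdorff _ _) c).
apply: limr_ge; first by apply/cvg_ex; exists (M * 0).
by near=> k; apply: hx.
Unshelve. all: by end_near.
Qed.

Lemma expr_differentiable (k : nat) (x : C) : differentiable (fun y : C => y ^+ k) x.
Proof.
elim: k => [|k IH].
  rewrite (_ : (fun y => y ^+ 0) = cst 1); first exact: differentiable_cst.
  by apply/funext => y; rewrite expr0.
rewrite (_ : (fun y => y ^+ k.+1) = (fun y => y * y ^+ k)).
  by apply: differentiableM => //; exact: ex_diff.
by apply/funext => y; rewrite exprS.
Qed.

(* Since phi vanishes near 0, phi(z) / z^k is holomorphic; let k tend to infinity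
   in the bound given by the maximum principle. *)
Lemma disc_identity (phi : C -> C) (rho M r0 : R) : 0 < r0 -> hol phi 0 rho ->
  (forall z, nm z < rho -> nm (phi z) <= M) ->
  (forall z, nm z < r0 -> phi z = 0) -> forall z, nm z < rho -> phi z = 0.
Proof.
move=> r00 hphi hM h0 z hz.
case: (ltP (nm z) r0) => hzr; first exact: h0.
have z0 : 0 < nm z by apply: lt_le_trans hzr.
pose rho' := (nm z + rho) / 2.
have [r1 r2] : nm z < rho' /\ rho' < rho by rewrite /rho'; split; lra.
clearbody rho'.
have r'0 : 0 < rho' := lt_trans z0 r1.
have M0 : 0 <= M by apply: le_trans (nm_ge0 (phi z)) (hM _ hz).
apply/eqP; rewrite -nm_eq0 eq_le nm_ge0 andbT.
apply: (@geometric_small (nm z / rho') M).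
  by rewrite divr_ge0 ?nm_ge0 ?ltW//= ltr_pdivrMr// mul1r.
move=> k; have zk : 0 < nm z ^+ k by rewrite exprn_gt0.
suff : nm (phi z / z ^+ k) <= M / rho' ^+ k.
  rewrite nmM nmV nmX ler_pdivrMr// => h; apply: le_trans h _.
  by rewrite exprMn exprVn -mulrA (mulrC (_^-1)).
apply: (@max_principle (fun x => phi x / x ^+ k) rho rho' _ (M / r0 ^+ k)) => //.
- by rewrite r'0.
- move=> x; rewrite subr0 => hx; have [x0|xn0] := eqVneq x 0.
    apply: (@near_diff _ _ _ (cst 0) (fun x => phi x / x ^+ k) x r0 r00 _ _).1.
      by move=> h; rewrite x0 add0r => hh; rewrite h0// mul0r.
    exact: differentiable_cst.
  apply: differentiableM; first by apply: hphi; rewrite subr0.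
  apply: (@differentiable_comp _ _ _ _ (fun x : C => x ^+ k) (fun x : C => x^-1)).
    exact: expr_differentiable.
  by apply: differentiable_Rinv; rewrite expf_neq0.
- move=> x hx; case: (ltP (nm x) r0) => hxr.
    by rewrite h0// mul0r nm0 divr_ge0// exprn_ge0// ltW.
  rewrite nmM nmV nmX; apply: ler_pM; rewrite ?nm_ge0 ?invr_ge0 ?exprn_ge0 ?nm_ge0 ?hM//.
  have x0 : 0 < nm x by apply: lt_le_trans hxr.
  rewrite lef_pV2 ?posrE ?exprn_gt0//.
  by apply: lerXn2r; rewrite ?nnegrE ?nm_ge0 ?(ltW r00).
- move=> x /andP[h1 h2]; have x0 : 0 < nm x by apply: lt_le_trans h1.
  rewrite nmM nmV nmX; apply: ler_pM; rewrite ?nm_ge0 ?invr_ge0 ?exprn_ge0 ?nm_ge0 ?hM//.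
  rewrite lef_pV2 ?posrE ?exprn_gt0//.
  by apply: lerXn2r; rewrite ?nnegrE ?nm_ge0 ?(ltW r'0).
Qed.

(** Restrict [f] to the complex line through [y] and [z], with parameter 0 at [y] and 1 at [z]. As
    both points lie in the quarter ball, z - y has norm at most rho / 2, and the parameter disc of
    radius 3/2 stays in the ball: 1/4 + 3/2 * 1/2 = 1. *)
Lemma ball_identity (V : normedModType C) (f : V -> C) c y (rho M r0 : R) :
  hol f c rho -> (forall z, nm (z - c) < rho -> nm (f z) <= M) ->
  0 < r0 -> (forall h, nm h < r0 -> f (y + h) = 0) ->
  nm (y - c) < rho / 4 -> forall z, nm (z - c) < rho / 4 -> f z = 0.
Proof.
move=> hf hM r00 hy yc z zc.
pose u := z - y; have uE : nm u <= rho / 2.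
  rewrite /u (_ : z - y = (z - c) - (y - c)); last by rewrite opprB addrA subrK.
  by apply: le_trans (nmB _ _) _; lra.
have u0 := nm_ge0 u.
have line (x : C) : nm x < 3 / 2 -> nm (y + x *: u - c) < rho.
  move=> hx; rewrite addrAC; apply: le_lt_trans (nmD _ _) _; rewrite nmZ.
  have := nm_ge0 x; nra.
rewrite -(subrK y z) addrC -/u -[u]scale1r.
apply: (@disc_identity (fun x => f (y + x *: u)) (3 / 2) M (r0 / (nm u + 1))).
- by rewrite divr_gt0// ltr_wpDl.
- move=> x; rewrite subr0 => /line hx.
  apply: (@differentiable_comp _ _ _ _ (fun x : C => y + x *: u) f); last exact: hf.
  apply: differentiableD; first exact: differentiable_cst.
  exact: differentiableZl.
- by move=> x /line; apply: hM.
- move=> x; rewrite ltr_pdivlMr ?ltr_wpDl// => hx; apply: hy; rewrite nmZ.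
  by have := nm_ge0 x; nra.
- by rewrite nm1; lra.
Qed.

End Identity.

(** * The Poincare lemma *)

Section Poincare.
Context {R : realType}.
Local Notation C := (CC R).

Lemma rder_idM (A : R -> C) t (d : C) : rder A t d ->
  rder (fun s => cR s * A s) t (A t + cR t * d).
Proof.
move=> hA e e0; have t1 : 0 < `|t| + 1 by rewrite ltr_wpDl.
have e20 : 0 < e / 2 by rewrite divr_gt0.
have [|r r0 hr] := hA (e / 2 / (`|t| + 1)); first by rewrite divr_gt0.
have [r' r'0 hr'] := rder_rcont hA e20.
exists (Num.min r r'); first by rewrite lt_min r0.
move=> h; rewrite lt_min => /andP[/hr h1 /hr' h2].
rewrite (_ : _ - _ = cR t * (A (t + h) - A t - cR h * d) + cR h * (A (t + h) - A t)).
  apply: le_trans (nmD _ _) _; rewrite !nmM !nm_cR.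
  have h3 : `|h| * nm (A (t + h) - A t) <= `|h| * (e / 2) by rewrite ler_wpM2l// ltW.
  have : `|t| * nm (A (t + h) - A t - cR h * d) <= e / 2 * `|h|.
    apply: le_trans (_ : (`|t| + 1) * nm (A (t + h) - A t - cR h * d) <= _).
      by rewrite ler_wpM2r ?nm_ge0// lerDl.
    by rewrite mulrC -ler_pdivlMr// mulrAC.
  lra.
by rewrite cRD; ring.
Qed.

(* The primitive is F z = int_0^1 theta (c + t (z - c)) (z - c) dt; closedness
   turns the derivative of its increment into d/dt [t theta (c + t (z - c)) h]. *)
Lemma poincare (V : normedModType C) (theta : V -> V -> C) c (rho M : R) :
  0 < rho ->
  (forall z, nm (z - c) < rho -> linear (theta z)) ->
  (forall v, hol (fun z => theta z v) c rho) ->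
  (forall z v, nm (z - c) < rho -> nm (theta z v) <= M * nm v) ->
  (forall z u v, nm (z - c) < rho ->
    'd (fun w => theta w v) z u = 'd (fun w => theta w u) z v) ->
  exists F : V -> C, forall z, nm (z - c) < rho / 8 ->
    differentiable F z /\ forall v, 'd F z v = theta z v.
Proof.
move=> rho0 lin hth hM closed.
(* Primitives on [0, 1] are built from continuity on [-1, 2], so the ray is prolonged by a factor up
   to 2; the radius [rho / 4] leaves room for it. *)
have seg z (t : R) : nm (z - c) < rho / 4 -> -1 <= t <= 2 -> nm (c + cR t *: (z - c) - c) < rho.
  move=> hz /andP[t1 t2]; rewrite addrAC subrr add0r nmZ nm_cR.
  have : `|t| <= 2 by rewrite ler_norml; apply/andP; split; lra.
  have := nm_ge0 (z - c); nra.
have /choice[P hP] : forall z, exists Pz : R -> C, nm (z - c) < rho / 4 ->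
    forall t, 0 <= t <= 1 -> rder Pz t (theta (c + cR t *: (z - c)) (z - c)).
  move=> z; case: (ltP (nm (z - c)) (rho / 4)) => hz; last by exists (fun=> 0).
  have [||Q hQ] := @rantiderivative _ (fun t => theta (c + cR t *: (z - c)) (z - c)) (-1) 2.
  - by lra.
  - move=> t ht; apply: (@rcont_line _ _ (fun w => theta w (z - c))).
    by apply: differentiable_continuous; apply: hth; apply: seg.
  - exists Q => _ t /andP[t0 t1]; apply: hQ; apply/andP; split; lra.
exists (fun z => P z 1 - P z 0) => z hz.
have z4 : nm (z - c) < rho / 4 by lra.
have zr : nm (z - c) < rho by lra.
pose y := z - c; have yn : nm y < rho / 8 by [].
have M0 : 0 <= M * nm y by apply: le_trans (hM _ y zr); apply: nm_ge0.
(* The first term is the [taylor2] constant of [theta w y], a function bounded by [M * nm y]. The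
   second comes from the [lip_bound] constant of [theta w h], whose bound already carries a factor
   [nm h]. *)
pose K := 128 * (M * nm y) / rho ^+ 2 + 8 * `|M| / rho.
have k8 : 0 <= 8 * `|M| / rho by rewrite divr_ge0 ?mulr_ge0// ltW.
have k128 : 0 <= 128 * (M * nm y) / rho ^+ 2.
  by rewrite divr_ge0 ?exprn_ge0 ?(ltW rho0)// mulr_ge0.
have K0 : 0 <= K by apply: addr_ge0.
have main h : nm h < rho / 8 ->
    nm ((P (z + h) 1 - P (z + h) 0) - (P z 1 - P z 0) - theta z h) <= K * nm h * nm h.
  move=> hh.
  have zh4 : nm (z + h - c) < rho / 4.
    by rewrite addrAC; apply: le_lt_trans (nmD _ _) _; lra.
  have := @rder_nm_le _ (fun t => P (z + h) t - P z t - cR t * theta (c + cR t *: y) h)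
    (fun t => theta (c + cR t *: (z + h - c)) (z + h - c) - theta (c + cR t *: y) y
      - (theta (c + cR t *: y) h + cR t * 'd (fun w => theta w h) (c + cR t *: y) y))
    0 1 (K * nm h * nm h) ler01.
  rewrite cR0 cR1 mul0r mul1r scale1r subr0 subr0 mulr1.
  have -> : c + y = z by rewrite /y addrC subrK.
  rewrite (_ : _ - _ - _ - (_ - _) = (P (z + h) 1 - P (z + h) 0) - (P z 1 - P z 0) - theta z h); last by ring.
  apply=> t ht.
    apply: rderB; first by apply: rderB; apply: hP.
    apply: rder_idM; apply: (@rder_line _ _ (fun w => theta w h)).
    by apply: hth; apply: seg => //; case/andP: ht => *; apply/andP; split; lra.
  have /andP[t0 t1] := ht.
  set p := c + cR t *: y.
  have tn (w : V) : nm (cR t *: w) <= nm w.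
    by rewrite nmZ nm_cR ger0_norm// ler_piMl// nm_ge0.
  have pc : nm (p - c) < rho / 8.
    by rewrite /p addrAC subrr add0r; apply: le_lt_trans (tn _) _.
  have pth : c + cR t *: (z + h - c) = p + cR t *: h.
    by rewrite (addrAC z) scalerDr addrA.
  have pthc : nm (p + cR t *: h - c) < rho / 4.
    by rewrite addrAC; apply: le_lt_trans (nmD _ _) _; have := tn h; lra.
  have pr : nm (p + cR t *: h - c) < rho by lra.
  rewrite pth (addrAC z h) -/y closed; last by lra.
  have -> : theta (p + cR t *: h) (y + h) = theta (p + cR t *: h) y + theta (p + cR t *: h) h.
    by have := lin _ pr 1 y h; rewrite !scale1r.
  have -> : cR t * 'd (fun w => theta w y) p h = 'd (fun w => theta w y) p (cR t *: h).
    by rewrite -scaleCE linearZ.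
  (* What closedness leaves is a Taylor remainder of [theta w y] plus an increment of [theta w h],
     both of second order in [h]. *)
  rewrite (_ : _ - _ = (theta (p + cR t *: h) y - theta p y - 'd (fun w => theta w y) p (cR t *: h))
    + (theta (p + cR t *: h) h - theta p h)); last by ring.
  have b1 := @taylor2 _ _ (fun w => theta w y) c rho (M * nm y) rho0 (hth y) (fun w => hM w y) p (cR t *: h).
  have b2 := @lip_bound _ _ (fun w => theta w h) c rho (M * nm h) rho0 (hth h) (fun w => hM w h) p (cR t *: h).
  apply: le_trans (nmD _ _) _; rewrite /K mulrDl mulrDl; apply: lerD.
    apply: le_trans (b1 _ _) _ => //; first by lra.
    have := tn h; have := nm_ge0 (cR t *: h) => i1 i2.
    by rewrite -[leLHS]mulrA -[leRHS]mulrA ler_wpM2l//; apply: ler_pM.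
  apply: le_trans (b2 _ _) _; [by lra|by lra|].
  have i0 := nm_ge0 h; have := tn h; have := nm_ge0 (cR t *: h) => i1 i2.
  have Mh : 8 * (M * nm h) / rho <= 8 * `|M| / rho * nm h.
    by rewrite [leRHS]mulrAC ler_pM2r ?invr_gt0// -[leRHS]mulrA ler_pM2l// ler_wpM2r// ler_norm.
  have k0 : 0 <= 8 * `|M| / rho * nm h by rewrite mulr_ge0.
  apply: le_trans (_ : 8 * `|M| / rho * nm h * nm (cR t *: h) <= _).
    by rewrite ler_wpM2r.
  by rewrite ler_wpM2l.
have [|F1 F2] := @eps_diff _ _ _ (fun z => P z 1 - P z 0) z (theta z) M (lin z zr) (fun h => hM z h zr).
- move=> e e0; exists (Num.min (rho / 8) (e / (K + 1))); split.
    by rewrite lt_min !divr_gt0// ltr_wpDl.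
  move=> h; rewrite lt_min => /andP[h1]; rewrite ltr_pdivlMr ?ltr_wpDl// => h2.
  apply: le_trans (main h h1) _; rewrite ler_wpM2r ?nm_ge0//.
  by move: h2; rewrite mulrDr mulr1 mulrC; have := nm_ge0 h; lra.
- by split => // v; rewrite F2.
Qed.

End Poincare.

(** * Rules of differentiation *)

Section Derivatives.
Context {R : realType}.
Local Notation C := (CC R).

Section Rules.
Context {V : normedModType C}.
Implicit Types (f g : V -> C) (c z v : V).

(** Differentiability and the value travel together, so the rules below compose as proof terms and
    nothing is rewritten under a differential. *)
Definition hasD f z v (d : C) := differentiable f z /\ 'd f z v = d.

Lemma hasD_d f z v : differentiable f z -> hasD f z v ('d f z v).
Proof. by []. Qed.

Lemma hasD_eq f z v d d' : hasD f z v d -> d = d' -> hasD f z v d'.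
Proof. by move=> + <-. Qed.

Lemma hasDM f g z v a b : hasD f z v a -> hasD g z v b ->
  hasD (fun w => f w * g w) z v (a * g z + f z * b).
Proof.
move=> [df <-] [dg <-]; split; first exact: differentiableM.
have -> : (fun w => f w * g w) = f * g by [].
apply: etrans (congr1 (fun F : V -> C => F v) (diffM df dg)) _.
by rewrite fctE/= addrC (mulrC _ (g z)).
Qed.

Lemma hasDV g z v b : hasD g z v b -> g z != 0 ->
  hasD (fun w => (g w)^-1) z v (- b / (g z) ^+ 2).
Proof.
move=> [dg <-] g0; split; first exact: differentiableV.
apply: etrans (congr1 (fun F : V -> C => F v) (diffV dg g0)) _.
by rewrite /= scaleCE mulNr mulNr mulrC.
Qed.

Lemma hasD_div f g z v a b : hasD f z v a -> hasD g z v b -> g z != 0 ->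
  hasD (fun w => f w / g w) z v ((a * g z - f z * b) / (g z) ^+ 2).
Proof.
move=> hf hg g0; apply: (hasD_eq (hasDM hf (hasDV hg g0))).
by field.
Qed.

Lemma hasDD f g z v a b : hasD f z v a -> hasD g z v b ->
  hasD (fun w => f w + g w) z v (a + b).
Proof.
move=> [df <-] [dg <-]; split; first exact: differentiableD.
have -> : (fun w => f w + g w) = f + g by [].
by apply: etrans (congr1 (fun F : V -> C => F v) (diffD df dg)) _.
Qed.

Lemma hasD_cst k z v : hasD (fun=> k) z v 0.
Proof.
split; first exact: differentiable_cst.
have E : ('d (cst k) z : V -> C) = 0 by exact: diff_cst.
exact: (congr1 (fun F : V -> C => F v) E).
Qed.

Lemma hasD_near f g z v d (r : R) : 0 < r ->
  (forall h, nm h < r -> f (z + h) = g (z + h)) -> hasD f z v d -> hasD g z v d.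
Proof.
move=> r0 fg [df <-]; have [dg E] := near_diff r0 fg df; split; first exact: dg.
exact: (congr1 (fun F : V -> C => F v) E).
Qed.

Lemma hasD_exp f z v d : hasD f z v d ->
  hasD (fun w => cexp (f w)) z v (d * cexp (f z)).
Proof.
move=> [df <-]; have [de dE] := cexp_diff (f z).
split; first exact: differentiable_comp.
apply: etrans (congr1 (fun F : V -> C => F v) (diff_comp df de)) _.
by rewrite /= dE mulrC.
Qed.

Lemma hol_at f c (r : R) z : hol f c r -> nm (z - c) < r ->
  exists2 r' : R, 0 < r' & hol f z r'.
Proof.
move=> hf hz; exists (r - nm (z - c)); first by rewrite subr_gt0.
by apply: hol_ball hf; lra.
Qed.

Lemma hol_diff f c (r : R) v : hol f c r -> hol (fun w => 'd f w v) c r.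
Proof. by move=> hf z /(hol_at hf)[r' r'0 /(hol_derive v r'0)]. Qed.

Lemma hol_diff_sym f c (r : R) z u v : hol f c r -> nm (z - c) < r ->
  'd (fun w => 'd f w u) z v = 'd (fun w => 'd f w v) z u.
Proof. by move=> hf /(hol_at hf)[r' r'0 /(hol_derive_sym u v r'0)]. Qed.

Lemma nonzero_near f c : {for c, continuous f} -> f c != 0 -> exists2 r : R, 0 < r &
  forall z, nm (z - c) < r -> f z != 0.
Proof.
move=> /cont_epsP cf f0; have [|d [d0 hd]] := cf (nm (f c)); first by rewrite nm_gt0.
exists d => // z /hd; rewrite (addrC c) subrK => h.
by apply/eqP => z0; move: h; rewrite z0 sub0r nmN ltxx.
Qed.

(** A nonzero difference would stay nonzero on a small ball, and that ball meets [Q]. *)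
Lemma dense_eq f g c (r : R) (Q : V -> Prop) : hol f c r -> hol g c r ->
  (forall z, nm (z - c) < r -> forall e : R, 0 < e -> exists2 y, nm (y - z) < e & Q y) ->
  (forall y, nm (y - c) < r -> Q y -> f y = g y) ->
  forall z, nm (z - c) < r -> f z = g z.
Proof.
move=> hf hg dQ fg z hz; apply/eqP; rewrite -subr_eq0; apply/negPn/negP => fgz.
have [|d d0 hd] := @nonzero_near (fun w => f w - g w) z _ fgz.
  by apply: differentiable_continuous; apply: differentiableB; [apply: hf|apply: hg].
have [|y hy Qy] := dQ z hz (Num.min d (r - nm (z - c))).
  by rewrite lt_min d0 subr_gt0.
move: hy; rewrite lt_min => /andP[/hd + hy2].
rewrite fg ?subrr ?eqxx// (_ : y - c = (y - z) + (z - c)); last by rewrite addrA subrK.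
by apply: le_lt_trans (nmD _ _) _; lra.
Qed.

End Rules.

(** * The principal square root *)

Definition csqrt (x : C) : C := sqrtc x.

Lemma csqrt2 x : csqrt x ^+ 2 = x. Proof. exact: sqr_sqrtc. Qed.

Lemma csqrt_gt0 x : 0 < re x -> 0 < re (csqrt x).
Proof.
case: x => a b; rewrite /re /csqrt /= => a0; rewrite sqrtr_gt0 divr_gt0//.
by rewrite ltr_wpDl// sqrtr_ge0.
Qed.

Lemma csqrt_real (a : R) : 0 <= a -> csqrt (cR (a ^+ 2)) = cR a.
Proof.
move=> a0; rewrite /csqrt sqrtc_sqrtr; last by rewrite lecR sqr_ge0.
by rewrite /= sqrtr_sqr ger0_norm.
Qed.

(** If s and s' are the roots at x and x + h, then h = (s' - s) (s' + s), and s' + s stays away from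
    0 because both roots have positive real part. *)
Lemma csqrt_diff x : 0 < re x -> differentiable csqrt x.
Proof.
move=> x0; set s := csqrt x; have a0 : 0 < re s := csqrt_gt0 x0.
set a := re s in a0.
have as' : a <= nm s by apply: le_trans (ler_norm _) (re_le_nm s).
have s0 : s != 0 by rewrite -nm_gt0 (lt_le_trans a0).
have [|||//] := @eps_diff _ C C csqrt x (fun h => h / (2 * s)) (nm (2 * s))^-1.
- by move=> k u v; rewrite !scaleCE mulrDl mulrA.
- by move=> h; rewrite (nmM h) nmV mulrC.
(* The remainder is - h^2 / ((s' + s)^2 * 2 s), with denominator of norm at least [a ^+ 3]; the
   bound [re x] keeps x + h in the right half-plane. *)
- move=> e e0; exists (Num.min (re x) (e * a ^+ 3)); split.
    by rewrite lt_min x0 mulr_gt0// exprn_gt0.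
  move=> h; rewrite lt_min => /andP[h1 h2]; set s' := csqrt (x + h).
  have s'0 : 0 < re s'.
    apply: csqrt_gt0; rewrite reD.
    have := re_le_nm h; rewrite ler_norml => /andP[+ _]; lra.
  have sa : a <= nm (s' + s).
    apply: le_trans (re_le_nm _); apply: le_trans (ler_norm _); rewrite reD -/a; lra.
  have ss0 : s' + s != 0 by rewrite -nm_gt0 (lt_le_trans a0).
  have hE : h = (s' - s) * (s' + s).
    by rewrite -subr_sqr !csqrt2 addrAC subrr add0r.
  have -> : s' - s - h / (2 * s) = - (h * h / ((s' + s) * (s' + s) * (2 * s))).
    by rewrite hE; field; rewrite s0 ss0.
  rewrite nmN nmM nmV !nmM.
  have n2 : nm (2 : C) = 2.
    by rewrite (_ : 2 = cR 2) ?nm_cR ?ger0_norm// /cR rmorph_nat.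
  rewrite n2 ler_pdivrMr; last by rewrite !mulr_gt0// ?(lt_le_trans a0).
  rewrite mulrAC ler_wpM2r ?nm_ge0//; apply: le_trans (ltW h2) _.
  have a1 := ltW a0.
  have i1 : a * a <= nm (s' + s) * nm (s' + s) by apply: ler_pM.
  rewrite ler_pM2l// (_ : a ^+ 3 = a * a * a); last by ring.
  by apply: ler_pM; rewrite ?mulr_ge0//; lra.
Qed.

(** * Row vectors: the Poincare lemma without a given bound *)

Section RowVectors.
Context {n : nat}.
Local Notation V := 'rV[C]_n.

Lemma nm_entry (v : V) j : nm (v 0 j) <= nm v.
Proof.
rewrite -le_cR -!nmE [leRHS]/Num.norm/= mx_normE.
have /= := num_le (`|v 0 j|%:nng) (\big[Num.max/0%:nng]_i `|v i.1 i.2|%:nng); move=> ->.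
exact: (le_bigmax _ (fun i : 'I_1 * 'I_n => `|v i.1 i.2|%:nng) (0, j)).
Qed.

Lemma linear_row (L : V -> C) : linear L ->
  forall v, L v = \sum_j v 0 j * L (delta_mx 0 j).
Proof.
move=> lin v; pose L' : {linear V -> C} := HB.pack L (GRing.isLinear.Build _ _ _ _ L lin).
rewrite -[L]/(L' : V -> C) {1}(row_sum_delta v) linear_sum; apply: eq_bigr => j _.
by rewrite linearZ.
Qed.

Lemma nm_sum (I : Type) (s : seq I) (F : I -> C) :
  nm (\sum_(i <- s) F i) <= \sum_(i <- s) nm (F i).
Proof.
elim: s => [|i s IH]; first by rewrite !big_nil nm0.
by rewrite !big_cons; apply: le_trans (nmD _ _) _; rewrite lerD2l.
Qed.

(** In finite dimension, bounds at the basis vectors near [c] control the whole form; this yields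
    the uniform [M] that [poincare] takes as a hypothesis. *)
Lemma linear_bounded_near (theta : V -> V -> C) c (r : R) : 0 < r ->
  (forall z, nm (z - c) < r -> linear (theta z)) ->
  (forall v, hol (fun z => theta z v) c r) ->
  exists r' M : R, 0 < r' <= r /\ forall z v, nm (z - c) < r' -> nm (theta z v) <= M * nm v.
Proof.
move=> r0 lin hth.
have fin (s : seq V) : exists r' M : R, 0 < r' <= r /\
    forall z v, nm (z - c) < r' -> v \in s -> nm (theta z v) <= M.
  elim: s => [|u s [r1 [M1 [/andP[r10 r1r] h1]]]]; first by exists r, 0; split; [rewrite r0 lexx|move=> z v _; rewrite in_nil].
  have [r2 [M2 [/andP[r20 r2r] _ h2]]] := hol_bounded r0 (hth u).
  exists (Num.min r1 r2), (Num.max M1 M2); split.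
    by rewrite lt_min r10 r20 ge_min r1r.
  move=> z v; rewrite lt_min inE => /andP[z1 z2] /orP[/eqP ->|vs].
    by rewrite le_max h2 ?orbT.
  by rewrite le_max h1.
have [r' [M [hr hM]]] := fin [seq delta_mx 0 j | j : 'I_n].
exists r', (\sum_(j < n) M); split => // z v hz.
rewrite linear_row; last by apply: lin; case/andP: hr => _; apply: lt_le_trans.
apply: le_trans (nm_sum _ _) _; rewrite mulr_suml; apply: ler_sum => j _.
rewrite nmM mulrC; apply: ler_pM; rewrite ?nm_ge0// ?nm_entry//.
by apply: hM => //; apply: map_f; rewrite mem_enum.
Qed.

Lemma poincare_rV (theta : V -> V -> C) c (r : R) : 0 < r ->
  (forall z, nm (z - c) < r -> linear (theta z)) ->
  (forall v, hol (fun z => theta z v) c r) ->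
  (forall z u v, nm (z - c) < r ->
    'd (fun w => theta w v) z u = 'd (fun w => theta w u) z v) ->
  exists (F : V -> C) (r' : R), 0 < r' <= r /\ forall z, nm (z - c) < r' ->
    differentiable F z /\ forall v, 'd F z v = theta z v.
Proof.
move=> r0 lin hth closed.
have [r1 [M [/andP[r10 r1r] hM]]] := linear_bounded_near r0 lin hth.
have [|||F hF] := @poincare _ _ theta c r1 M r10 _ _ hM.
- by move=> z hz; apply: lin; apply: lt_le_trans r1r.
- by move=> v z hz; apply: hth; apply: lt_le_trans r1r.
- by move=> z u v hz; apply: closed; apply: lt_le_trans r1r.
by exists F, (r1 / 8); split => //; rewrite divr_gt0//=; lra.
Qed.

End RowVectors.
End Derivatives.

(** * Local factorization *)

(* Stated over an arbitrary field because [field] and unification diverge on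
   the differentials that instantiate the variables. *)
Section FieldIdentities.
Context {F : fieldType}.


(** Dictionary: u = dF1(e1), p = dF1(e2), q = dF2(e1), u' = dF2(e2); a, d are du at e1, e2 and a',
    d' are du' at e1, e2. X4, X5 are the derivatives of [coef] along e1, e2, X3 that of [beta_e1]
    along e2, X2 that of [alpha_e2] along e1. Nonvanishing of k = [kappa] amounts to that of u u' -
    p q, the determinant of dF1, dF2 on the span of e1, e2. *)
Lemma theta1_identity (X4 c X3 b X5 X2 k u u' p q a a' d d' : F) :
  u != 0 -> u' != 0 -> k != 0 -> c = u * u' -> b = q / u' -> k = 1 - p / u * b ->
  X4 = a * u' + u * a' -> X5 = d * u' + u * d' ->
  X3 = (a' * u' - q * d') / u' ^+ 2 -> X2 = (d * u - p * a) / u ^+ 2 ->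
  (X4 / c - X3 - b * (X5 / c) + b * X2) / k = a / u.
Proof.
move=> u0 u'0 k0 -> bE kE -> -> -> ->; have k1 : u * u' - p * q != 0.
  apply: contraNneq k0 => k1; apply/eqP.
  have -> : k = (u * u' - p * q) / (u * u') by rewrite kE bE; field; rewrite u0 u'0.
  by rewrite k1 mul0r.
by rewrite kE bE; field; rewrite u0 u'0 k1.
Qed.

Lemma theta_identity (T A D u a s f : F) : u != 0 ->
  T = a / u -> A = f / u -> D = (s * u - f * a) / u ^+ 2 -> T * A + D = s / u.
Proof. by move=> u0 -> -> ->; field. Qed.

Lemma closed_identity (X Y m m' a b u : F) :
  X = (m * u - a * b) / u ^+ 2 -> Y = (m' * u - b * a) / u ^+ 2 -> m = m' -> X = Y.
Proof. by move=> -> -> ->; rewrite (mulrC a). Qed.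

(** The relation theta ^ alpha + d alpha = 0 evaluated on two vectors, for alpha = dF1 / u and theta
    = du / u; m = m' is the symmetry of the second derivatives of F1. *)
Lemma closed_identity1 (Tx Tv Av Ax X Y m m' a b f g u : F) : u != 0 ->
  Tx = a / u -> Tv = b / u -> Av = f / u -> Ax = g / u ->
  X = (m * u - f * a) / u ^+ 2 -> Y = (m' * u - g * b) / u ^+ 2 -> m = m' ->
  Tx * Av + X = Tv * Ax + Y.
Proof. by move=> u0 -> -> -> -> -> -> ->; field. Qed.

(** The counterpart d(c beta) = theta ^ (c beta), which holds because c beta = u dF2. *)
Lemma closed_identity2 (Tx Tv c Bv Bx X Y m m' a b f g u u' : F) : u != 0 -> u' != 0 ->
  Tx = a / u -> Tv = b / u -> c = u * u' -> Bv = f / u' -> Bx = g / u' ->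
  X = a * f + u * m -> Y = b * g + u * m' -> m = m' ->
  X - Tx * (c * Bv) = Y - Tv * (c * Bx).
Proof. by move=> u0 u'0 -> -> -> -> -> -> -> ->; field; rewrite u0 u'0. Qed.

Lemma product_identity (q c A B f g u u' : F) : u != 0 -> u' != 0 ->
  q = f * g -> c = u * u' -> A = f / u -> B = g / u' -> q = c * A * B.
Proof. by move=> u0 u'0 -> -> -> ->; field; rewrite u0 u'0. Qed.

Lemma mul_divK (a b c : F) : b != 0 -> a * c = a * b * (c / b).
Proof. by move=> b0; field. Qed.

End FieldIdentities.

Section Factorization.
Context {R : realType}.
Local Notation C := (CC R).
Context {V : normedModType C} (B : V -> V -> V -> C) (e1 e2 : V).
Implicit Types (z v x : V).

(* On the span of e1 and e2, B = coef * alpha * beta with alpha(e1) = beta(e2) = 1.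
   If u alpha and (coef / u) beta are closed, then theta = du / u satisfies
   theta(v) = theta(e1) alpha(v) + d(alpha(v))(e1), and similarly for beta with
   dcoef / coef - theta; solving these relations at e1, e2 gives [theta1]. *)
Definition disc z := B z e1 e2 ^+ 2 - B z e1 e1 * B z e2 e2.
Definition coef z := B z e1 e2 + csqrt (disc z).
Definition alpha_e2 z := B z e2 e2 / coef z.
Definition beta_e1 z := B z e1 e1 / coef z.
Definition kappa z := 1 - alpha_e2 z * beta_e1 z.
Definition alpha v z := 2 * (B z v e2 - alpha_e2 z * B z v e1) / (coef z * kappa z).
Definition beta v z := 2 * (B z v e1 - beta_e1 z * B z v e2) / (coef z * kappa z).
Definition theta1 z :=
  ('d coef z e1 / coef z - 'd beta_e1 z e2 - beta_e1 z * ('d coef z e2 / coef z) + beta_e1 z * 'd alpha_e2 z e1) / kappa z.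
Definition theta v z := theta1 z * alpha v z + 'd (alpha v) z e1.

(** A positive real part keeps [disc] off the branch cut of [csqrt] and separates the two roots of
    the quadratic equation; [coef] and [kappa] are the denominators in all the formulas above. *)
Definition nondegenerate z := [/\ 0 < re (disc z), coef z != 0 & kappa z != 0].

Section Regularity.
Context (c : V) (r : R) (holB : forall u v, hol (fun z => B z u v) c r).

Lemma hol_disc : hol disc c r.
Proof.
move=> z hz; apply: differentiableB.
  have -> : (fun z => B z e1 e2 ^+ 2) = (fun z => B z e1 e2 * B z e1 e2) by apply/funext => w; rewrite expr2.
  by apply: differentiableM; apply: holB.
by apply: differentiableM; apply: holB.
Qed.

Lemma coef_diff z : nm (z - c) < r -> 0 < re (disc z) -> differentiable coef z.
Proof.
move=> hz hd; apply: differentiableD; first exact: holB.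
apply: (@differentiable_comp _ _ _ _ disc csqrt); first exact: hol_disc.
exact: csqrt_diff.
Qed.

Lemma alpha_beta_diff z : nm (z - c) < r -> 0 < re (disc z) -> coef z != 0 ->
  [/\ differentiable alpha_e2 z, differentiable beta_e1 z & differentiable kappa z].
Proof.
move=> hz hd c0; have dc := coef_diff hz hd.
have da : differentiable alpha_e2 z.
  by apply: differentiableM; [exact: holB|exact: differentiableV].
have db : differentiable beta_e1 z.
  by apply: differentiableM; [exact: holB|exact: differentiableV].
split; [exact: da|exact: db|].
apply: differentiableB; first exact: differentiable_cst.
by apply: differentiableM; [exact: da|exact: db].
Qed.

(** With these values [disc] is 1/4, and [coef] and [kappa] are 1 at [c]; all three conditions are
    open. *)
Lemma nondegenerate_near : 0 < r -> B c e1 e1 = 0 -> B c e2 e2 = 0 -> B c e1 e2 = 2^-1 ->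
  exists r' : R, 0 < r' <= r /\ forall z, nm (z - c) < r' -> nondegenerate z.
Proof.
move=> r0 h11 h22 h12.
have c0 : nm (c - c) < r by rewrite subrr nm0.
have dE : disc c = cR (2^-1 ^+ 2).
  rewrite /disc h11 h22 mul0r subr0 h12 /cR rmorphXn/= fmorphV/=.
  by rewrite rmorph_nat.
have s0 : csqrt (disc c) = 2^-1.
  by rewrite dE csqrt_real// /cR fmorphV rmorph_nat.
have ccE : coef c = 1 by rewrite /coef s0 h12; field.
have d0 : 0 < re (disc c) by rewrite dE re_cR.
have ccn : coef c != 0 by rewrite ccE oner_eq0.
have [_ _ dk] := alpha_beta_diff c0 d0 ccn.
have [d d0' hd] : exists2 d : R, 0 < d & forall z, nm (z - c) < d -> 0 < re (disc z).
  have /cont_epsP/(_ _ d0)[d [d00 hd]] := differentiable_continuous (hol_disc c0).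
  exists d => // z /hd; rewrite (addrC c) subrK => h.
  have := re_le_nm (disc z - disc c); rewrite reD reN ler_norml => /andP[+ _]; lra.
have [d1 d10 hd1] := nonzero_near (differentiable_continuous (coef_diff c0 d0)) ccn.
have [|d2 d20 hd2] := nonzero_near (differentiable_continuous dk).
  by rewrite /kappa /alpha_e2 h22 mul0r mul0r subr0 oner_eq0.
exists (Num.min r (Num.min d (Num.min d1 d2))); split.
  by rewrite !lt_min r0 d0' d10 d20 ge_min lexx.
move=> z; rewrite !lt_min => /and4P[_ /hd ? /hd1 ? /hd2 ?]; split=> //.
Qed.

Context (hgood : forall z, nm (z - c) < r -> nondegenerate z).

Lemma hol_coef : hol coef c r.
Proof. by move=> z hz; have [? _ _] := hgood hz; apply: coef_diff. Qed.
Lemma hol_alpha_e2 : hol alpha_e2 c r.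
Proof. by move=> z hz; have [? ? _] := hgood hz; have [] := alpha_beta_diff hz. Qed.
Lemma hol_beta_e1 : hol beta_e1 c r.
Proof. by move=> z hz; have [? ? _] := hgood hz; have [] := alpha_beta_diff hz. Qed.
Lemma hol_kappa : hol kappa c r.
Proof. by move=> z hz; have [? ? _] := hgood hz; have [] := alpha_beta_diff hz. Qed.

Lemma hol_mulf f g : hol f c r -> hol g c r -> hol (fun z : V => f z * g z : C) c r.
Proof. by move=> hf hg z hz; apply: differentiableM; [exact: hf|exact: hg]. Qed.
Lemma hol_subf f g : hol f c r -> hol g c r -> hol (fun z : V => f z - g z : C) c r.
Proof. by move=> hf hg z hz; apply: differentiableB; [exact: hf|exact: hg]. Qed.
Lemma hol_addf f g : hol f c r -> hol g c r -> hol (fun z : V => f z + g z : C) c r.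
Proof. by move=> hf hg z hz; apply: differentiableD; [exact: hf|exact: hg]. Qed.
Lemma hol_cstf (k : C) : hol (fun z : V => k) c r.
Proof. by move=> z _; exact: differentiable_cst. Qed.
Lemma hol_divf (f g : V -> C) : hol f c r -> hol g c r -> (forall z, nm (z - c) < r -> g z != 0) ->
  hol (fun z : V => f z / g z : C) c r.
Proof.
move=> hf hg g0 z hz; apply: differentiableM; first exact: hf.
by apply: differentiableV; [exact: hg|exact: g0].
Qed.

Lemma hol_alpha v : hol (alpha v) c r.
Proof.
apply: hol_divf.
- apply: hol_mulf; first exact: hol_cstf.
  by apply: hol_subf; [exact: holB|apply: hol_mulf; [exact: hol_alpha_e2|exact: holB]].
- by apply: hol_mulf; [exact: hol_coef|exact: hol_kappa].
- by move=> z /hgood[_ ? ?]; rewrite mulf_neq0.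
Qed.
Lemma hol_beta v : hol (beta v) c r.
Proof.
apply: hol_divf.
- apply: hol_mulf; first exact: hol_cstf.
  by apply: hol_subf; [exact: holB|apply: hol_mulf; [exact: hol_beta_e1|exact: holB]].
- by apply: hol_mulf; [exact: hol_coef|exact: hol_kappa].
- by move=> z /hgood[_ ? ?]; rewrite mulf_neq0.
Qed.
Lemma hol_theta1 : hol theta1 c r.
Proof.
have cc0 z : nm (z - c) < r -> coef z != 0 by move=> /hgood[].
have h1 : hol (fun z => 'd coef z e1 / coef z) c r.
  by apply: hol_divf; [apply: hol_diff; exact: hol_coef|exact: hol_coef|exact: cc0].
have h2 : hol (fun z => 'd coef z e2 / coef z) c r.
  by apply: hol_divf; [apply: hol_diff; exact: hol_coef|exact: hol_coef|exact: cc0].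
apply: hol_divf; [|exact: hol_kappa|by move=> z /hgood[]].
apply: hol_addf; last by apply: hol_mulf; [exact: hol_beta_e1|apply: hol_diff; exact: hol_alpha_e2].
apply: hol_subf; last by apply: hol_mulf; [exact: hol_beta_e1|exact: h2].
by apply: hol_subf; [exact: h1|apply: hol_diff; exact: hol_beta_e1].
Qed.
Lemma hol_theta v : hol (theta v) c r.
Proof.
apply: hol_addf; last by apply: hol_diff; exact: hol_alpha.
by apply: hol_mulf; [exact: hol_theta1|exact: hol_alpha].
Qed.

End Regularity.

Lemma alpha_linear : (forall z u, linear (fun v => B z v u)) -> forall z, linear (fun v => alpha v z).
Proof.
move=> lin z k u v; rewrite /alpha (lin z e2 k u v) (lin z e1 k u v) !scaleCE; ring.
Qed.

Lemma beta_linear : (forall z u, linear (fun v => B z v u)) -> forall z, linear (fun v => beta v z).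
Proof.
move=> lin z k u v; rewrite /beta (lin z e2 k u v) (lin z e1 k u v) !scaleCE; ring.
Qed.

Lemma theta_linear c (r : R) : (forall z u, linear (fun v => B z v u)) ->
  (forall v, hol (alpha v) c r) -> forall z, nm (z - c) < r -> linear (fun v => theta v z).
Proof.
move=> lin hal z hz k u v.
have alE w : alpha (k *: u + v) w = k * alpha u w + alpha v w := alpha_linear lin w k u v.
have [_ E] : hasD (alpha (k *: u + v)) z e1 (k * 'd (alpha u) z e1 + 'd (alpha v) z e1).
  have -> : alpha (k *: u + v) = (fun w => k * alpha u w + alpha v w) by apply/funext.
  have H := hasDD (hasDM (hasD_cst k z e1) (hasD_d e1 (hal u z hz))) (hasD_d e1 (hal v z hz)).
  by apply: (hasD_eq H); rewrite mul0r add0r.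
have alg (t a b d e : C) : t * (k * a + b) + (k * d + e) = k * (t * a + d) + (t * b + e).
  by ring.
apply: etrans (alg _ _ _ _ _).
exact: (congr2 (fun s t => theta1 z * s + t) (alE z) E).
Qed.

Section Generic.
Context (F1 F2 : V -> C) (y : V) (r : R).

(* The root [coef] of [X^2 - 2 B(e1,e2) X + B(e1,e1) B(e2,e2)] is one of the two
   products dF1(e1) dF2(e2), dF1(e2) dF2(e1), the same one near y. *)
Definition generic := [/\ hol F1 y r, hol F2 y r & forall z, nm (z - y) < r ->
  [/\ 'd F1 z e1 != 0, 'd F2 z e2 != 0, kappa z != 0, coef z = 'd F1 z e1 * 'd F2 z e2 &
      forall v, [/\ alpha v z = 'd F1 z v / 'd F1 z e1, beta v z = 'd F2 z v / 'd F2 z e2,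
        alpha_e2 z = 'd F1 z e2 / 'd F1 z e1, beta_e1 z = 'd F2 z e1 / 'd F2 z e2 &
        B z v v = 'd F1 z v * 'd F2 z v]]].

Context (r0 : 0 < r) (gen : generic).

Let u z := 'd F1 z e1.
Let u' z := 'd F2 z e2.

Lemma generic_near z (f g : V -> C) v d : nm (z - y) < r ->
  (forall z, nm (z - y) < r -> f z = g z) -> hasD f z v d -> hasD g z v d.
Proof.
move=> hz fg; apply: (@hasD_near _ _ _ _ _ _ _ (r - nm (z - y))); first by rewrite subr_gt0.
move=> h hh; apply: fg; rewrite addrAC; apply: le_lt_trans (nmD _ _) _; lra.
Qed.

Lemma generic_F1 v z : nm (z - y) < r -> differentiable (fun w => 'd F1 w v) z.
Proof. by have [h _ _] := gen; move: z; apply: hol_diff. Qed.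
Lemma generic_F2 v z : nm (z - y) < r -> differentiable (fun w => 'd F2 w v) z.
Proof. by have [_ h _] := gen; move: z; apply: hol_diff. Qed.

Lemma generic_alpha z v x : nm (z - y) < r ->
  hasD (alpha v) z x (('d (fun w => 'd F1 w v) z x * u z - 'd F1 z v * 'd u z x) / u z ^+ 2).
Proof.
move=> hz; have [_ _ H] := gen.
apply: (generic_near hz (f := fun w => 'd F1 w v / u w)).
  by move=> w /H[_ _ _ _ /(_ v)[-> _ _ _ _]].
apply: (hasD_div (hasD_d _ (generic_F1 v hz)) (hasD_d _ (generic_F1 e1 hz))).
by have [] := H z hz.
Qed.

Lemma generic_alpha_e2 z x : nm (z - y) < r ->
  hasD alpha_e2 z x (('d (fun w => 'd F1 w e2) z x * u z - 'd F1 z e2 * 'd u z x) / u z ^+ 2).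
Proof.
move=> hz; have [_ _ H] := gen.
apply: (generic_near hz (f := fun w => 'd F1 w e2 / u w)).
  by move=> w /H[_ _ _ _ /(_ e1)[_ _ -> _ _]].
apply: (hasD_div (hasD_d _ (generic_F1 e2 hz)) (hasD_d _ (generic_F1 e1 hz))).
by have [] := H z hz.
Qed.

Lemma generic_beta_e1 z x : nm (z - y) < r ->
  hasD beta_e1 z x (('d (fun w => 'd F2 w e1) z x * u' z - 'd F2 z e1 * 'd u' z x) / u' z ^+ 2).
Proof.
move=> hz; have [_ _ H] := gen.
apply: (generic_near hz (f := fun w => 'd F2 w e1 / u' w)).
  by move=> w /H[_ _ _ _ /(_ e1)[_ _ _ -> _]].
apply: (hasD_div (hasD_d _ (generic_F2 e1 hz)) (hasD_d _ (generic_F2 e2 hz))).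
by have [] := H z hz.
Qed.

Lemma generic_coef z x : nm (z - y) < r ->
  hasD coef z x ('d u z x * u' z + u z * 'd u' z x).
Proof.
move=> hz; have [_ _ H] := gen.
apply: (generic_near hz (f := fun w => u w * u' w)).
  by move=> w /H[_ _ _ -> _].
exact: (hasDM (hasD_d _ (generic_F1 e1 hz)) (hasD_d _ (generic_F2 e2 hz))).
Qed.

(** This justifies the formula for [theta1]: built from [B] alone, it recovers du / u for whichever
    generic pair F1, F2 decomposes [B]. *)
Lemma generic_theta z v : nm (z - y) < r -> theta v z = 'd u z v / u z.
Proof.
move=> hz; have [hF1 hF2 H] := gen.
have [u0 u'0 k0 ccE /(_ v) [alE _ a2E b1E _]] := H z hz.
(* Symmetry of second derivatives turns the derivatives of dF1(v) along e1 into derivatives of u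
   along v, and likewise for u'. *)
have S1 : 'd (fun w => 'd F1 w v) z e1 = 'd u z v := hol_diff_sym v e1 hF1 hz.
have S2 : 'd (fun w => 'd F1 w e2) z e1 = 'd u z e2 := hol_diff_sym e2 e1 hF1 hz.
have S3 : 'd (fun w => 'd F2 w e1) z e2 = 'd u' z e1 := hol_diff_sym e1 e2 hF2 hz.
have D1 := etrans (generic_alpha v e1 hz).2
  (congr1 (fun t => (t * u z - 'd F1 z v * 'd u z e1) / u z ^+ 2) S1).
have D2 := etrans (generic_alpha_e2 e1 hz).2
  (congr1 (fun t => (t * u z - 'd F1 z e2 * 'd u z e1) / u z ^+ 2) S2).
have D3 := etrans (generic_beta_e1 e2 hz).2
  (congr1 (fun t => (t * u' z - 'd F2 z e1 * 'd u' z e2) / u' z ^+ 2) S3).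
have kE : kappa z = 1 - 'd F1 z e2 / u z * beta_e1 z := congr1 (fun t => 1 - t * beta_e1 z) a2E.
have th1E : theta1 z = 'd u z e1 / u z :=
  theta1_identity u0 u'0 k0 ccE b1E kE (generic_coef e1 hz).2 (generic_coef e2 hz).2 D3 D2.
exact: (theta_identity u0 th1E alE D1).
Qed.

(** None of the four conclusions mentions F1 or F2. They are equalities between functions defined on
    the whole ball, and so can be extended from a dense set of points [y]. *)
Lemma generic_identities v x : [/\ 'd (theta v) y x = 'd (theta x) y v,
  theta x y * alpha v y + 'd (alpha v) y x = theta v y * alpha x y + 'd (alpha x) y v,
  'd (fun w => coef w * beta v w) y x - theta x y * (coef y * beta v y) =
  'd (fun w => coef w * beta x w) y v - theta v y * (coef y * beta x y) &
  B y v v = coef y * alpha v y * beta v y].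
Proof.
have [hF1 hF2 H] := gen; have hy : nm (y - y) < r by rewrite subrr nm0.
have [u0 u'0 k0 ccE H0] := H y hy.
have hu : hol u y r by apply: hol_diff.
have thD s t : 'd (theta s) y t = ('d (fun w => 'd u w s) y t * u y - 'd u y s * 'd u y t) / u y ^+ 2.
  apply: (generic_near hy (f := fun w => 'd u w s / u w) _ _).2.
    by move=> w hw; exact: esym (generic_theta s hw).
  by apply: (hasD_div (hasD_d _ _) (hasD_d _ (generic_F1 e1 hy)) u0); apply: (hol_diff s hu).
have cbD s t : 'd (fun w => coef w * beta s w) y t =
    'd u y t * 'd F2 y s + u y * 'd (fun w => 'd F2 w s) y t.
  apply: (generic_near hy (f := fun w => u w * 'd F2 w s) _ _).2.
    by move=> w /H[_ w0 _ -> /(_ s)[_ -> _ _ _]]; exact: mul_divK.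
  exact: (hasDM (hasD_d _ (generic_F1 e1 hy)) (hasD_d _ (generic_F2 s hy))).
have alD s t := (generic_alpha s t hy).2.
have alE s : alpha s y = 'd F1 y s / u y by have [] := H0 s.
have beE s : beta s y = 'd F2 y s / u' y by have [] := H0 s.
split.
- exact: (closed_identity (thD v x) (thD x v) (hol_diff_sym v x hu hy)).
- exact: (closed_identity1 u0 (generic_theta x hy) (generic_theta v hy) (alE v) (alE x) (alD v x) (alD x v)
    (hol_diff_sym v x hF1 hy)).
- exact: (closed_identity2 u0 u'0 (generic_theta x hy) (generic_theta v hy) ccE (beE v) (beE x)
    (cbD v x) (cbD x v) (hol_diff_sym v x hF2 hy)).
- by have [a b _ _ q] := H0 v; exact: (product_identity u0 u'0 q ccE a b).
Qed.

End Generic.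
End Factorization.

(** * Polarization and the quadratic equation for the coefficient *)

Section PolarIdentities.
Context {F : numFieldType}.

(** Cramer's rule: p1 and p2 are the values of the polar form at (v, e1) and (v, e2), p2 - a p1
    eliminates Bv, and c k is the determinant A1 B2 - A2 B1. *)
Lemma alpha_identity (A1 A2 Av B1 B2 Bv c a b k p1 p2 : F) : A1 != 0 -> B2 != 0 -> k != 0 ->
  c = A1 * B2 -> a = A2 / A1 -> b = B1 / B2 -> k = 1 - a * b ->
  p1 = (Av * B1 + A1 * Bv) / 2 -> p2 = (Av * B2 + A2 * Bv) / 2 ->
  2 * (p2 - a * p1) / (c * k) = Av / A1.
Proof.
move=> A0 B0 k0 -> -> -> kE -> ->; rewrite kE in k0 *.
have k1 : A1 * B2 - A2 * B1 != 0.
  apply: contraNneq k0 => k1; apply/eqP.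
  have -> : 1 - A2 / A1 * (B1 / B2) = (A1 * B2 - A2 * B1) / (A1 * B2).
    by field; rewrite A0 B0.
  by rewrite k1 mul0r.
by field; rewrite ?A0 ?B0 ?k1.
Qed.

(** The products A1 B2 and A2 B1 have half-sum w and product A1 B1 A2 B2, so they are the roots of a
    quadratic equation that c satisfies. *)
Lemma root_identity (s w c A1 A2 B1 B2 : F) : c = w + s -> w = (A1 * B2 + A2 * B1) / 2 ->
  s ^+ 2 = w ^+ 2 - A1 * B1 * (A2 * B2) -> (c - A1 * B2) * (c - A2 * B1) = 0.
Proof.
move=> -> wE sE.
have -> : (w + s - A1 * B2) * (w + s - A2 * B1) = s ^+ 2 - (w ^+ 2 - A1 * B1 * (A2 * B2)).
  by rewrite wE; field.
by rewrite sE subrr.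
Qed.

Lemma ratio_left (q c p u u' : F) : u != 0 -> u' != 0 -> c = u * u' -> q = p * u' ->
  q / c = p / u.
Proof. by move=> u0 u'0 -> ->; field; rewrite u0 u'0. Qed.

Lemma ratio_right (q c p u u' : F) : u != 0 -> u' != 0 -> c = u * u' -> q = u * p ->
  q / c = p / u'.
Proof. by move=> u0 u'0 -> ->; field; rewrite u0 u'0. Qed.

Lemma polar_swap (q a b d e : F) : q = (a * b + d * e) / 2 -> q = (b * a + e * d) / 2.
Proof. by move=> ->; rewrite mulrC [b * a]mulrC [e * d]mulrC [X in _ = X]mulrC. Qed.

Lemma polar_swapC (q a b d e : F) : q = (a * b + d * e) / 2 -> q = (e * d + b * a) / 2.
Proof. by move=> /polar_swap ->; rewrite addrC. Qed.

Lemma polar_identity (q x uu vv f1 f2 g1 g2 s t : F) : q = uu + x + (x + vv) -> q = s * t ->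
  s = f1 + f2 -> t = g1 + g2 -> uu = f1 * g1 -> vv = f2 * g2 -> x = (f1 * g2 + f2 * g1) / 2.
Proof.
move=> qE qE' sE tE uE vE; have -> : x = (uu + x + (x + vv) - uu - vv) / 2 by field.
by rewrite -qE qE' sE tE uE vE; field.
Qed.

Lemma half_sum (s c w p q : F) : c = w + s -> w = (p + q) / 2 -> s = ((c - p) + (c - q)) / 2.
Proof. by move=> -> ->; field. Qed.

End PolarIdentities.

(** * Decomposition on a ball around a normalized point *)

Section LocalDecomposition.
Context {R : realType}.
Local Notation C := (CC R).

Section Existence.
Context {V : normedModType C} (B : V -> V -> V -> C) (e1 e2 : V).

Lemma generic_of_root (F1 F2 : V -> C) y (r : R) : hol F1 y r -> hol F2 y r ->
  (forall z, nm (z - y) < r -> [/\ nondegenerate B e1 e2 z, coef B e1 e2 z = 'd F1 z e1 * 'd F2 z e2,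
    (forall v, B z v v = 'd F1 z v * 'd F2 z v) &
    forall u v, B z u v = ('d F1 z u * 'd F2 z v + 'd F1 z v * 'd F2 z u) / 2]) ->
  generic B e1 e2 F1 F2 y r.
Proof.
move=> h1 h2 H; split; [exact: h1|exact: h2|move=> z hz].
 have [[_ c0 k0] cE dB pB] := H z hz.
have /andP[u0 u'0] : ('d F1 z e1 != 0) && ('d F2 z e2 != 0).
  by rewrite -negb_or -mulf_eq0 -cE.
have aE : alpha_e2 B e1 e2 z = 'd F1 z e2 / 'd F1 z e1.
  exact: ratio_left u0 u'0 cE (dB e2).
have bE : beta_e1 B e1 e2 z = 'd F2 z e1 / 'd F2 z e2.
  exact: ratio_right u0 u'0 cE (dB e1).
split; [exact: u0|exact: u'0|exact: k0|exact: cE|move=> v].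
split; [| |exact: aE|exact: bE|exact: dB].
- exact: (alpha_identity u0 u'0 k0 cE aE bE erefl (pB v e1) (pB v e2)).
(* [beta] is [alpha] with (F1, e1) and (F2, e2) exchanged; [coef] and [kappa] are symmetric under
   this exchange. *)
- exact: (alpha_identity u'0 u0 k0 (etrans cE (mulrC _ _)) bE aE
    (congr1 (fun t => 1 - t) (mulrC _ _)) (polar_swapC (pB v e2)) (polar_swapC (pB v e1))).
Qed.

(** At every point [coef] is one of the products dF1(e1) dF2(e2), dF1(e2) dF2(e1). It cannot equal
    both at [y], since [csqrt] of [disc] would then vanish; so one factor of the equation in [roots]
    is nonzero near [y] and the other is identically 0 there. In the second case F1 and F2 are
    swapped. *)
Lemma generic_exists (F1 F2 : V -> C) y (r : R) : 0 < r -> hol F1 y r -> hol F2 y r ->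
  (forall z u, linear (fun v => B z v u)) -> (forall u v, hol (fun z => B z u v) y r) ->
  (forall z, nm (z - y) < r -> nondegenerate B e1 e2 z) ->
  (forall z u v, nm (z - y) < r -> B z u v = B z v u) ->
  (forall z v, nm (z - y) < r -> B z v v = 'd F1 z v * 'd F2 z v) ->
  exists (G1 G2 : V -> C) (s : R), 0 < s /\ generic B e1 e2 G1 G2 y s.
Proof.
move=> r0 h1 h2 lin holB hgood sym dB.
have pB z u v : nm (z - y) < r ->
    B z u v = ('d F1 z u * 'd F2 z v + 'd F1 z v * 'd F2 z u) / 2.
  move=> hz; have addl a b w : B z (a + b) w = B z a w + B z b w.
    by have := lin z w 1 a b; rewrite !scale1r.
  have Dl (G : V -> C) a b : 'd G z (a + b) = 'd G z a + 'd G z b by exact: linearD.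
  have E : B z (u + v) (u + v) = B z u u + B z u v + (B z u v + B z v v).
    by rewrite addl (sym _ u (u + v))// (sym _ v (u + v))// !addl (sym z v u hz).
  exact: (polar_identity E (dB z _ hz) (Dl F1 u v) (Dl F2 u v) (dB z u hz) (dB z v hz)).
have roots z : nm (z - y) < r ->
    (coef B e1 e2 z - 'd F1 z e1 * 'd F2 z e2) * (coef B e1 e2 z - 'd F1 z e2 * 'd F2 z e1) = 0.
  move=> hz; apply: (root_identity (s := csqrt (disc B e1 e2 z)) erefl (pB z e1 e2 hz)).
  by rewrite csqrt2 /disc !dB.
have hcc : hol (coef B e1 e2) y r by exact: hol_coef.
have d1 a b : hol (fun z => coef B e1 e2 z - 'd F1 z a * 'd F2 z b) y r.
  by apply: hol_subf; [exact: hcc|apply: hol_mulf; apply: hol_diff].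
have hy : nm (y - y) < r by rewrite subrr nm0.
have near1 a b : coef B e1 e2 y - 'd F1 y a * 'd F2 y b != 0 ->
    exists2 s : R, 0 < s <= r & forall z, nm (z - y) < s -> coef B e1 e2 z - 'd F1 z a * 'd F2 z b != 0.
  move=> /(nonzero_near (differentiable_continuous (d1 a b y hy)))[s s0 hs].
  exists (Num.min s r); first by rewrite lt_min s0 r0 ge_min lexx orbT.
  by move=> z; rewrite lt_min => /andP[/hs].
have sub (f : V -> C) s : s <= r -> hol f y r -> hol f y s.
  by move=> sr hf z hz; apply: hf; apply: lt_le_trans sr.
have [E1|N1] := eqVneq (coef B e1 e2 y - 'd F1 y e2 * 'd F2 y e1) 0.
  have [E2|/near1[s /andP[s0 sr] hs]] := eqVneq (coef B e1 e2 y - 'd F1 y e1 * 'd F2 y e2) 0.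
    exfalso; have [re0 _ _] := hgood y hy.
    have : csqrt (disc B e1 e2 y) = 0.
      have -> : csqrt (disc B e1 e2 y) = ((coef B e1 e2 y - 'd F1 y e1 * 'd F2 y e2) +
         (coef B e1 e2 y - 'd F1 y e2 * 'd F2 y e1)) / 2.
        exact: half_sum erefl (pB y e1 e2 hy).
      by rewrite E1 E2 addr0 mul0r.
    by move=> s0; have := csqrt_gt0 re0; rewrite s0 ltxx.
  exists F2, F1, s; split=> //; apply: generic_of_root; [exact: sub|exact: sub|].
  move=> z hz; have hzr : nm (z - y) < r by apply: lt_le_trans sr.
  split; first exact: hgood.
  - have /eqP := roots z hzr; rewrite mulf_eq0 (negbTE (hs z hz)) /= subr_eq0 => /eqP ->.
    by rewrite mulrC.
  - by move=> v; exact: etrans (dB z v hzr) (mulrC _ _).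
  - by move=> u v; exact: polar_swapC (pB z u v hzr).
have [s /andP[s0 sr] hs] := near1 _ _ N1.
exists F1, F2, s; split=> //; apply: generic_of_root; [exact: sub|exact: sub|].
move=> z hz; have hzr : nm (z - y) < r by apply: lt_le_trans sr.
split; first exact: hgood.
- by have /eqP := roots z hzr; rewrite mulf_eq0 (negbTE (hs z hz)) orbF subr_eq0 => /eqP.
- by move=> v; exact: dB.
- by move=> u v; exact: pB.
Qed.

End Existence.

Lemma exp_closed1 (F : fieldType) (E Tx Tv Av Ax X Y : F) : Tx * Av + X = Tv * Ax + Y ->
  Tx * E * Av + E * X = Tv * E * Ax + E * Y.
Proof. by move=> H; rewrite -!mulrA !(mulrCA _ E) -!mulrDr H. Qed.

Lemma exp_closed2 (F : fieldType) (E Tx Tv f g X Y : F) : E != 0 ->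
  X - Tx * f = Y - Tv * g ->
  (X * E - f * (Tx * E)) / E ^+ 2 = (Y * E - g * (Tv * E)) / E ^+ 2.
Proof.
move=> E0 H; congr (_ / _).
have -> : X * E - f * (Tx * E) = (X - Tx * f) * E by ring.
by rewrite H; ring.
Qed.

Lemma factor_identity (F : fieldType) (E q a b d f g : F) : E != 0 -> q = d * a * b ->
  f = E * a -> g = d * b / E -> q = f * g.
Proof. by move=> E0 -> -> ->; field. Qed.

Section LocalTheorem.
Context {n : nat} (B : 'rV[C]_n -> 'rV[C]_n -> 'rV[C]_n -> C) (e1 e2 c : 'rV[C]_n).

Definition decomposable_near (y : 'rV[C]_n) :=
  exists (F1 F2 : 'rV[C]_n -> C) (s : R), [/\ 0 < s, hol F1 y s, hol F2 y s &
    forall z v, nm (z - y) < s -> B z v v = 'd F1 z v * 'd F2 z v].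

Theorem local_decomposition (r : R) : 0 < r ->
  (forall z u, linear (fun v => B z v u)) -> (forall u v, hol (fun z => B z u v) c r) ->
  (forall z u v, nm (z - c) < r -> B z u v = B z v u) ->
  B c e1 e1 = 0 -> B c e2 e2 = 0 -> B c e1 e2 = 2^-1 ->
  (forall z, nm (z - c) < r -> forall e : R, 0 < e ->
    exists2 y, nm (y - z) < e & decomposable_near y) ->
  decomposable_near c.
Proof.
move=> r0 lin holB0 sym0 h11 h22 h12 dense0.
have [r1 [/andP[r10 r1r] hgood]] := nondegenerate_near holB0 r0 h11 h22 h12.
have holB u v : hol (fun z => B z u v) c r1.
  by move=> z hz; apply: holB0; apply: lt_le_trans r1r.
have dense z : nm (z - c) < r1 -> forall e : R, 0 < e ->
    exists2 y, nm (y - z) < e & decomposable_near y.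
  by move=> hz; apply: dense0; apply: lt_le_trans r1r.
have ids y : nm (y - c) < r1 -> decomposable_near y ->
    exists (G1 G2 : 'rV[C]_n -> C) (s : R), 0 < s /\ generic B e1 e2 G1 G2 y s.
  move=> hy [F1 [F2 [s [s0 hF1 hF2 HB]]]].
  pose t := Num.min s (r1 - nm (y - c)).
  have t0 : 0 < t by rewrite lt_min s0 subr_gt0.
  have ts : t <= s by rewrite ge_min lexx.
  have tc z : nm (z - y) < t -> nm (z - c) < r1.
    rewrite lt_min => /andP[_ hz]; rewrite (_ : z - c = (z - y) + (y - c)).
      by apply: le_lt_trans (nmD _ _) _; lra.
    by rewrite addrA subrK.
  apply: (@generic_exists _ B e1 e2 F1 F2 y t t0).
  - by move=> z hz; apply: hF1; apply: lt_le_trans ts.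
  - by move=> z hz; apply: hF2; apply: lt_le_trans ts.
  - exact: lin.
  - by move=> u v z /tc; apply: holB.
  - by move=> z /tc; apply: hgood.
  - by move=> z u v /tc hz; apply: sym0; apply: lt_le_trans r1r.
  - by move=> z v hz; apply: HB; apply: lt_le_trans ts.
have hcc := hol_coef holB hgood.
have hal v := hol_alpha holB hgood v; have hbe v := hol_beta holB hgood v.
have hth v := hol_theta holB hgood v.
have hcb v := hol_mulf hcc (hbe v).
(* [Q1] to [Q4] are the generic identities, carried by density from decomposable points to the whole
   ball. *)
have Q1 v x z : nm (z - c) < r1 -> 'd (theta B e1 e2 v) z x = 'd (theta B e1 e2 x) z v.
  apply: (dense_eq (hol_diff x (hth v)) (hol_diff v (hth x)) dense).
  by move=> y hy /(ids y hy)[G1 [G2 [s [s0 gen]]]]; have [] := generic_identities s0 gen v x.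
have Q2 v x z : nm (z - c) < r1 ->
    theta B e1 e2 x z * alpha B e1 e2 v z + 'd (alpha B e1 e2 v) z x =
    theta B e1 e2 v z * alpha B e1 e2 x z + 'd (alpha B e1 e2 x) z v.
  apply: (dense_eq (hol_addf (hol_mulf (hth x) (hal v)) (hol_diff x (hal v)))
    (hol_addf (hol_mulf (hth v) (hal x)) (hol_diff v (hal x))) dense).
  by move=> y hy /(ids y hy)[G1 [G2 [s [s0 gen]]]]; have [] := generic_identities s0 gen v x.
have Q3 v x z : nm (z - c) < r1 ->
    'd (fun w => coef B e1 e2 w * beta B e1 e2 v w) z x - theta B e1 e2 x z * (coef B e1 e2 z * beta B e1 e2 v z) =
    'd (fun w => coef B e1 e2 w * beta B e1 e2 x w) z v - theta B e1 e2 v z * (coef B e1 e2 z * beta B e1 e2 x z).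
  apply: (dense_eq (hol_subf (hol_diff x (hcb v)) (hol_mulf (hth x) (hcb v)))
    (hol_subf (hol_diff v (hcb x)) (hol_mulf (hth v) (hcb x))) dense).
  by move=> y hy /(ids y hy)[G1 [G2 [s [s0 gen]]]]; have [] := generic_identities s0 gen v x.
have Q4 v z : nm (z - c) < r1 ->
    B z v v = coef B e1 e2 z * alpha B e1 e2 v z * beta B e1 e2 v z.
  apply: (dense_eq (holB v v) (hol_mulf (hol_mulf hcc (hal v)) (hbe v)) dense).
  by move=> y hy /(ids y hy)[G1 [G2 [s [s0 gen]]]]; have [] := generic_identities s0 gen v v.
have [h [r2 [/andP[r20 r21] hh]]] := poincare_rV r10
  (theta_linear lin hal) hth (fun z u v hz => Q1 v u z hz).
have E0 z : cexp (h z) != 0 :> C := cexp_neq0 _.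
have hE z x : nm (z - c) < r2 ->
    hasD (fun w => cexp (h w)) z x (theta B e1 e2 x z * cexp (h z)).
  move=> hz; have [dh hd] := hh z hz.
  by apply: (hasD_eq (hasD_exp (hasD_d x dh))); rewrite hd.
have le21 z : nm (z - c) < r2 -> nm (z - c) < r1 by move=> hz; apply: lt_le_trans r21.
have D1 v z x : nm (z - c) < r2 -> hasD (fun w => cexp (h w) * alpha B e1 e2 v w) z x
    (theta B e1 e2 x z * cexp (h z) * alpha B e1 e2 v z + cexp (h z) * 'd (alpha B e1 e2 v) z x).
  by move=> hz; exact: (hasDM (hE z x hz) (hasD_d x (hal v z (le21 z hz)))).
have D2 v z x : nm (z - c) < r2 ->
    hasD (fun w => coef B e1 e2 w * beta B e1 e2 v w / cexp (h w)) z x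
    (('d (fun w => coef B e1 e2 w * beta B e1 e2 v w) z x * cexp (h z) -
      coef B e1 e2 z * beta B e1 e2 v z * (theta B e1 e2 x z * cexp (h z))) / cexp (h z) ^+ 2).
  by move=> hz; exact: (hasD_div (hasD_d x (hcb v z (le21 z hz))) (hE z x hz) (E0 z)).
(* In [D1 v z 0] the direction 0 is a dummy: only the differentiability is extracted. The same holds
   for [D2] below. *)
have [||F1 [s1 [/andP[s10 s12] hF1]]] := @poincare_rV _ _
    (fun z v => cexp (h z) * alpha B e1 e2 v z) c r2 r20 _ (fun v z hz => (D1 v z 0 hz).1).
- move=> z hz k u v; rewrite (alpha_linear e1 e2 lin z k u v) !scaleCE; ring.
- move=> z u v hz; apply: etrans (D1 v z u hz).2 (etrans _ (esym (D1 u z v hz).2)).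
  exact: exp_closed1 (Q2 v u z (le21 z hz)).
have [||F2 [s2 [/andP[s20 s22] hF2]]] := @poincare_rV _ _
    (fun z v => coef B e1 e2 z * beta B e1 e2 v z / cexp (h z)) c r2 r20 _ (fun v z hz => (D2 v z 0 hz).1).
- move=> z hz k u v; rewrite (beta_linear e1 e2 lin z k u v) !scaleCE; ring.
- move=> z u v hz; apply: etrans (D2 v z u hz).2 (etrans _ (esym (D2 u z v hz).2)).
  exact: exp_closed2 (E0 z) (Q3 v u z (le21 z hz)).
exists F1, F2, (Num.min s1 s2); split.
- by rewrite lt_min s10.
- by move=> z; rewrite lt_min => /andP[/hF1[]].
- by move=> z; rewrite lt_min => /andP[_ /hF2[]].
- move=> z v; rewrite lt_min => /andP[z1 z2].
  have [_ f1] := hF1 z z1; have [_ f2] := hF2 z z2.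
  exact: factor_identity (E0 z) (Q4 v z (lt_le_trans z1 (le_trans s12 r21))) (f1 v) (f2 v).
Qed.

End LocalTheorem.
End LocalDecomposition.

(** * Manifolds *)

Section LinearForms.
Context {F : fieldType} {V : vectType F}.
Implicit Types a b : 'Hom(V, F^o).

Lemma linform_neq0P a : a != 0 -> exists v, a v != 0.
Proof.
move=> a0; apply: contrapT => H; case/eqP: a0; apply/lfunP => v; rewrite lfunE /=.
by apply/eqP/negPn/negP => hv; apply: H; exists v.
Qed.

Lemma lker_sub_scale a b : a != 0 -> (forall v, a v = 0 -> b v = 0) ->
  exists k : F, forall v, b v = k * a v.
Proof.
move=> /linform_neq0P[v0 hv0] hab; exists (b v0 / a v0) => v.
have : b (v - (a v / a v0) *: v0) = 0.
  by apply: hab; rewrite linearB linearZ /= /GRing.scale/= divfK// subrr.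
rewrite linearB linearZ/= => /subr0_eq ->.
have alg (s t u : F) : s / t * u = u / t * s by ring.
exact: alg.
Qed.

Lemma lker_scale a b (k : F) : k != 0 -> (forall v, b v = k * a v) -> lker a = lker b.
Proof.
by move=> k0 hb; apply/vspaceP => v; rewrite !memv_ker hb mulf_eq0 (negbTE k0).
Qed.

Lemma scale_neq0 a b (k : F) : b != 0 -> (forall v, b v = k * a v) -> k != 0.
Proof.
by move=> /linform_neq0P[v bv] hb; apply: contraNneq bv => k0; rewrite hb k0 mul0r.
Qed.

(** If b were a multiple of a, the product would be a multiple of a^2, and the other factor a' would
    have the kernel of a. So a and b are independent, and vectors lying in one kernel but not in the
    other, rescaled, form the dual pair. *)
Lemma dual_basis a b a' b' : a != 0 -> a' != 0 -> lker a <> lker a' ->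
  (forall v, a v * b v = a' v * b' v) -> (exists v, a v * b v != 0) ->
  exists e1 e2, [/\ a e1 = 1, a e2 = 0, b e1 = 0 & b e2 = 1].
Proof.
move=> a0 a'0 Hk qE [v0 qv0].
have b0 : b != 0.
  by apply: contraNneq qv0 => ->; rewrite lfunE /= mulr0.
have nab (k : F) : (forall v, b v = k * a v) -> False.
  move=> hb; have k0 := scale_neq0 b0 hb.
  have [l hl] : exists l : F, forall v, a v = l * a' v.
    apply: lker_sub_scale => // v a'v; have := qE v.
    by rewrite a'v mul0r hb => /eqP; rewrite !mulf_eq0 (negbTE k0) /= orbb => /eqP.
  by apply: Hk; apply: esym; apply: lker_scale (scale_neq0 a0 hl) hl.
have [v2 [av2 bv2]] : exists v, a v = 0 /\ b v != 0.
  apply: contrapT => nv; have [|k hk] := @lker_sub_scale a b a0; last exact: nab hk.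
  by move=> v av; apply/eqP/negPn/negP => bv; apply: nv; exists v.
have [v1 [bv1 av1]] : exists v, b v = 0 /\ a v != 0.
  apply: contrapT => nv; have [|k hk] := @lker_sub_scale b a b0.
    by move=> v bv; apply/eqP/negPn/negP => av; apply: nv; exists v.
  by apply: (nab k^-1) => v; rewrite hk mulKf// (scale_neq0 a0 hk).
exists ((a v1)^-1 *: v1), ((b v2)^-1 *: v2).
by rewrite !linearZ/= av2 bv1 !scaler0; split=> //; exact: mulVf.
Qed.

End LinearForms.

Lemma hyperplanes_dual_basis (R : realType) (n : nat) (q : 'rV[CC R]_n -> CC R) :
  ~ (forall v, q v = 0) -> ~ (hyperplanes q #<= `I_1)%card ->
  exists a b : 'Hom('rV[CC R]_n, (CC R)^o), is_product q a b /\
  exists e1 e2, [/\ a e1 = 1, a e2 = 0, b e1 = 0 & b e2 = 1].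
Proof.
move=> q0 hq.
have [H1 [H2 [h1 h2 H12]]] : exists H1 H2, [/\ hyperplanes q H1, hyperplanes q H2 & H1 <> H2].
  apply: contrapT => nH; apply: hq.
  have [->|/set0P[H0 hH0]] := eqVneq (hyperplanes q) set0; first exact: card_ge0.
  apply: card_le_trans (card_image_le (fun=> H0) `I_1).
  apply: subset_card_le => H hH /=; exists 0%N => //.
  by apply: contrapT => HH0; apply: nH; exists H0, H; split.
have [a [b [a0 E qab]]] := h1; have [a' [b' [a'0 E' qab']]] := h2.
rewrite {}E {}E' in H12.
exists a, b; split; first exact: qab.
apply: (dual_basis a0 a'0 H12 (fun v => etrans (esym (qab v)) (qab' v))).
apply: contrapT => nv; apply: q0 => v; rewrite qab; apply/eqP/negPn/negP => qv.
by apply: nv; exists v.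
Qed.

(** * Charts, and density of the complement of a proper analytic set *)

Section Charts.
Context {R : realType} {n : nat} {X : complexManifold R n}.
Local Notation C := (CC R).
Implicit Types (p : X) (i : cm_chart X).

Lemma chart_nbhs i p (r : R) : cm_dom i p -> 0 < r ->
  nbhs p [set q : X | cm_dom i q /\ nm (cm_map i q - cm_map i p) < r].
Proof.
move=> hp r0; have co := @cm_map_continuous _ _ X i.
rewrite (continuous_open_subspace _ (@cm_open_dom _ _ X i)) in co.
have cp : {for p, continuous (cm_map i)} by apply: co; rewrite inE.
have : nbhs (cm_map i p) [set z | nm (z - cm_map i p) < r].
  apply: (proj2 (nearP _ (fun z => nm (z - cm_map i p) < r))).
  by exists r; split=> // h; rewrite addrAC subrr add0r.
move=> /cp hn; apply: filterI => //.
by apply: open_nbhs_nbhs; split; [exact: cm_open_dom|].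
Qed.

Lemma chart_ball i p (U : set X) : cm_dom i p -> nbhs p U ->
  exists2 r : R, 0 < r & forall z, nm (z - cm_map i p) < r ->
    [/\ cm_dom i (cm_inv i z), U (cm_inv i z) & cm_map i (cm_inv i z) = z].
Proof.
move=> hp hU; have co := @cm_inv_continuous _ _ X i.
rewrite (continuous_open_subspace _ (@cm_open_cod _ _ X i)) in co.
have himg : (cm_map i @` cm_dom i) (cm_map i p) by exists p.
have cp : {for cm_map i p, continuous (cm_inv i)} by apply: co; rewrite inE.
have : nbhs (cm_map i p) (cm_inv i @^-1` U `&` (cm_map i @` cm_dom i)).
  apply: filterI; last by apply: open_nbhs_nbhs; split; [exact: cm_open_cod|].
  by apply: cp; rewrite cm_mapK.
move=> /(proj1 (nearP _ (cm_inv i @^-1` U `&` (cm_map i @` cm_dom i))))[r [r0 hr]].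
exists r => // z hz.
have := hr (z - cm_map i p) hz; rewrite addrC subrK => -[/= hUz [q hq qz]].
by rewrite -qz cm_mapK//; split=> //; rewrite -(cm_mapK hq) qz.
Qed.

Lemma holomorphic_on_hol (U : set X) (f : X -> C) i (c : 'rV[C]_n) (r : R) :
  holomorphic_on U f ->
  (forall z, nm (z - c) < r -> [/\ cm_dom i (cm_inv i z), U (cm_inv i z) & cm_map i (cm_inv i z) = z]) ->
  hol (f \o cm_inv i : 'rV[C]_n -> C) c r.
Proof. by move=> hf hz z /hz[h1 h2 <-]; apply: hf. Qed.

Lemma finite_radius (m : nat) (P : 'I_m -> R -> Prop) :
  (forall k (r s : R), s <= r -> P k r -> P k s) ->
  (forall k, exists2 r : R, 0 < r & P k r) -> exists2 r : R, 0 < r & forall k, P k r.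
Proof.
move=> mono hP.
suff [r r0 hr] : exists2 r : R, 0 < r & forall k, k \in enum 'I_m -> P k r.
  by exists r => // k; apply: hr; rewrite mem_enum.
elim: (enum 'I_m) => [|k s [r r0 hr]]; first by exists 1.
have [r' r'0 hr'] := hP k; exists (Num.min r r'); first by rewrite lt_min r0.
move=> j; rewrite inE => /orP[/eqP ->|js].
  by apply: mono hr'; rewrite ge_min lexx orbT.
by apply: mono (hr j js); rewrite ge_min lexx.
Qed.

(** Near a limit point of the interior, the local equations vanish on a small ball close to that
    point; by the identity theorem they vanish on a ball around the point itself. *)
Lemma interior_analytic_closed (A : set X) : closed_analytic A -> closed A°.
Proof.
move=> hA x hx; have [U [oU Ux] [m [g [hg AU]]]] := hA x.
have [i hi] := cm_cover x.
have nU : nbhs x U by apply: open_nbhs_nbhs.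
have [r0 r00 hr0] := chart_ball hi nU.
have hgk k : hol (g k \o cm_inv i : 'rV[C]_n -> C) (cm_map i x) r0.
  exact: holomorphic_on_hol (hg k) hr0.
have [r rgt0 hr] : exists2 r : R, 0 < r & forall k, r <= r0 /\ exists M : R,
    forall w, nm (w - cm_map i x) < r -> nm ((g k \o cm_inv i) w) <= M.
  apply: finite_radius.
    move=> k r s sr [rr0 [M hM]]; split; first exact: le_trans rr0.
    by exists M => w hw; apply: hM; apply: lt_le_trans sr.
  move=> k; have [r [M [/andP[h1 h2] _ h3]]] := hol_bounded r00 (hgk k).
  by exists r => //; split=> //; exists M.
pose s := Num.min r r0; have s0 : 0 < s by rewrite lt_min rgt0.
have [sr sr0] : s <= r /\ s <= r0 by rewrite !ge_min !lexx orbT.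
(* [ball_identity] needs the centre of the small ball in the quarter ball, and concludes on that
   same quarter ball. *)
have hN := chart_nbhs hi (divr_gt0 s0 (ltr0n R 4)).
have [y [Ay [hy1 hy2]]] := hx _ (filterI hN nU).
have nAy : nbhs y A by [].
move: hy1 => [hyi hys].
have [t t0 ht] := chart_ball hyi (filterI nAy (open_nbhs_nbhs (conj oU hy2))).
have zero k z : nm (z - cm_map i x) < s / 4 -> (g k \o cm_inv i) z = 0.
  have [_ [M hM]] := hr k.
  apply: (@ball_identity _ _ (g k \o cm_inv i) (cm_map i x) (cm_map i y) s M t) => //.
  - by move=> w hw; apply: hgk; apply: lt_le_trans sr0.
  - by move=> w hw; apply: hM; apply: lt_le_trans sr.
  - move=> h hh; have [_ [h1 h2] _] := ht (cm_map i y + h) ltac:(by rewrite addrAC subrr add0r).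
    have : (A `&` U) (cm_inv i (cm_map i y + h)) by [].
    by rewrite AU => -[_ /(_ k)].
rewrite /interior; apply: filterS (filterI hN nU) => q [[hqi hqs] hqU].
have : (A `&` U) q.
  rewrite AU; split=> // k; have := zero k (cm_map i q) hqs.
  by rewrite /= cm_mapK.
by case.
Qed.

(** Otherwise the interior of [A] is nonempty, open and closed, and connectedness makes [A] the
    whole of [X]. *)
Lemma proper_analytic_dense (A : set X) : closed_analytic A -> A != [set: X] ->
  forall (x : X) (N : set X), nbhs x N -> exists2 y, N y & ~ A y.
Proof.
move=> hA nA x N hN; apply: contrapT => H.
have Ax : A° x.
  rewrite /interior; apply: filterS hN => y Ny.
  by apply: contrapT => nAy; apply: H; exists y.
have : A° = [set: X].
  apply: (@cm_connected _ _ X); first by exists x.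
    by exists A°; [exact: open_interior|rewrite setTI].
  by exists A°; [exact: interior_analytic_closed|rewrite setTI].
move=> AT; case/eqP: nA; rewrite eqEsubset; split=> // y _.
by apply: interior_subset; rewrite AT.
Qed.

Lemma transition_near i j p : cm_dom i p -> cm_dom j p ->
  exists2 r : R, 0 < r & forall h, nm h < r ->
   cm_inv j (cm_map j (cm_inv i (cm_map i p + h))) = cm_inv i (cm_map i p + h).
Proof.
move=> hi hj; have nj : nbhs p (cm_dom j).
  by apply: open_nbhs_nbhs; split; [exact: cm_open_dom|].
have [r r0 hr] := chart_ball hi nj; exists r => // h hh.
have [_ h2 _] := hr (cm_map i p + h) ltac:(by rewrite addrAC subrr add0r).
by rewrite cm_mapK.
Qed.

(** Differentials of functions on [X] are read in [chart_at p], which varies with [p] without any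
    regularity; this brings them back to one fixed chart. *)
Lemma diff_transition i j p (f : X -> C) : cm_dom i p -> cm_dom j p ->
  differentiable (f \o cm_inv j : 'rV[C]_n -> C) (cm_map j p) ->
  differentiable (f \o cm_inv i : 'rV[C]_n -> C) (cm_map i p) /\
  forall v, 'd (f \o cm_inv i : 'rV[C]_n -> C) (cm_map i p) v =
   'd (f \o cm_inv j : 'rV[C]_n -> C) (cm_map j p) (v *m 'J (cm_map j \o cm_inv i) (cm_map i p)).
Proof.
move=> hi hj df; have dt := cm_transition_holomorphic hi hj.
have [r r0 hr] := transition_near hi hj.
have E0 : (cm_map j \o cm_inv i) (cm_map i p) = cm_map j p by rewrite /= cm_mapK.
have df' : differentiable (f \o cm_inv j : 'rV[C]_n -> C) ((cm_map j \o cm_inv i) (cm_map i p)).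
  by rewrite E0.
have dc := differentiable_comp dt df'.
have [d1 d2] := @near_diff _ _ _ _ (f \o cm_inv i : 'rV[C]_n -> C) (cm_map i p) r r0
   (fun h hh => congr1 f (hr h hh)) dc.
split=> [|v]; first exact: d1.
apply: etrans (congr1 (fun F : 'rV[C]_n -> C => F v) d2) _.
apply: etrans (congr1 (fun F : 'rV[C]_n -> C => F v) (diff_comp dt df')) _.
by rewrite /jacobian mul_rV_lin1 -[cm_map j p]E0.
Qed.

End Charts.

(** * Symmetric differentials in a fixed chart *)

Section Transfer.
Context {R : realType} {n : nat} {X : complexManifold R n} (w : symDiff2 X).
Local Notation C := (CC R).
Implicit Types (p : X) (i : cm_chart X).

Definition sd_form i (z u v : 'rV[C]_n) : C := (u *m sd_coef w i z *m v^T) 0 0.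

Lemma sd_form_sum i z u v :
  sd_form i z u v = \sum_k \sum_j (u 0 j * v 0 k) * sd_coef w i z j k.
Proof.
rewrite /sd_form mxE; apply: eq_bigr => k _; rewrite !mxE mulr_suml.
by apply: eq_bigr => j _; rewrite mulrAC.
Qed.

Lemma sd_form_linear i z u : linear (fun v => sd_form i z v u).
Proof. by move=> k v v'; rewrite /sd_form !mulmxDl -!scalemxAl !mxE. Qed.

Lemma sd_form_sym i p u v : cm_dom i p ->
  sd_form i (cm_map i p) u v = sd_form i (cm_map i p) v u.
Proof.
move=> hp; have E : v *m sd_coef w i (cm_map i p) *m u^T =
    (u *m sd_coef w i (cm_map i p) *m v^T)^T.
  by rewrite !trmx_mul trmxK (sd_sym w hp) mulmxA.
by rewrite /sd_form E [RHS]mxE.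
Qed.

Lemma sd_form_differentiable i p u v : cm_dom i p ->
  differentiable (fun z => sd_form i z u v) (cm_map i p).
Proof.
move=> hp.
have hs (I : Type) (s : seq I) (f : I -> 'rV[C]_n -> C) :
    (forall k, differentiable (f k) (cm_map i p)) ->
    differentiable (fun z => \sum_(k <- s) f k z) (cm_map i p).
  move=> hf; elim: s => [|k s IH].
    rewrite (_ : (fun z => _) = cst 0); first exact: differentiable_cst.
    by apply/funext => z; rewrite big_nil.
  rewrite (_ : (fun z => _) = (fun z => f k z + \sum_(k <- s) f k z)).
    by apply: differentiableD; [exact: hf|exact: IH].
  by apply/funext => z; rewrite big_cons.
rewrite (_ : (fun z => _) = (fun z => \sum_k \sum_j (u 0 j * v 0 k) * sd_coef w i z j k)); last first.
  by apply/funext => z; exact: sd_form_sum.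
apply: (hs) => k; apply: (hs) => j; apply: differentiableM; first exact: differentiable_cst.
exact: sd_holomorphic.
Qed.

Lemma sd_form_transition i j p v : cm_dom i p -> cm_dom j p ->
  let v' := v *m 'J (cm_map j \o cm_inv i) (cm_map i p) in
  sd_form i (cm_map i p) v v = sd_form j (cm_map j p) v' v'.
Proof. by move=> hi hj /=; rewrite /sd_form (sd_transition w hi hj) trmx_mul !mulmxA. Qed.

Lemma chart_atP p : cm_dom (chart_at p) p.
Proof. by rewrite /chart_at; case: cid. Qed.

(** The form and the product of differentials are both pulled back by the same Jacobian from
    [chart_at q] to [i], so the equality may be checked in either chart. *)
Lemma exact_decomposition_local p i : cm_dom i p -> has_exact_decomposition w p ->
  decomposable_near (sd_form i) (cm_map i p).
Proof.
move=> hp [U [f1 [f2 [oU Up hf1 hf2 wE]]]].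
have [r r0 hr] := chart_ball hp (open_nbhs_nbhs (conj oU Up)).
exists (f1 \o cm_inv i), (f2 \o cm_inv i), r; split=> //.
- exact: holomorphic_on_hol hf1 hr.
- exact: holomorphic_on_hol hf2 hr.
move=> z v /hr[]; set q := cm_inv i z => hq Uq <-.
have hj := chart_atP q.
have [_ d1] := diff_transition hq hj (hf1 _ _ Uq hj).
have [_ d2] := diff_transition hq hj (hf2 _ _ Uq hj).
apply: etrans (sd_form_transition v hq hj) (etrans (wE q Uq _) _).
exact: esym (congr2 (fun s t => s * t) (d1 v) (d2 v)).
Qed.

Lemma local_exact_decomposition p i : cm_dom i p ->
  decomposable_near (sd_form i) (cm_map i p) -> has_exact_decomposition w p.
Proof.
move=> hp [F1 [F2 [s [s0 hF1 hF2 dB]]]].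
pose U := [set q : X | cm_dom i q /\ nm (cm_map i q - cm_map i p) < s]°.
have Uball q : U q -> cm_dom i q /\ nm (cm_map i q - cm_map i p) < s.
  exact: interior_subset.
have hol_comp (F : 'rV[C]_n -> C) : hol F (cm_map i p) s -> forall j q, U q -> cm_dom j q ->
    differentiable ((F \o cm_map i) \o cm_inv j : 'rV[C]_n -> C) (cm_map j q) /\
    forall v, 'd ((F \o cm_map i) \o cm_inv j : 'rV[C]_n -> C) (cm_map j q) v =
      'd F (cm_map i q) (v *m 'J (cm_map i \o cm_inv j) (cm_map j q)).
  move=> hF j q /Uball[hiq hq] hj; have dt := cm_transition_holomorphic hj hiq.
  have E0 : (cm_map i \o cm_inv j) (cm_map j q) = cm_map i q by rewrite /= cm_mapK.
  have dF : differentiable F ((cm_map i \o cm_inv j) (cm_map j q)).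
    by rewrite E0; exact: hF.
  split=> [|v]; first exact: (differentiable_comp dt dF).
  apply: etrans (congr1 (fun G : 'rV[C]_n -> C => G v) (diff_comp dt dF)) _.
  by rewrite /jacobian mul_rV_lin1 -[cm_map i q]E0.
exists U, (F1 \o cm_map i), (F2 \o cm_map i); split.
- exact: open_interior.
- exact: chart_nbhs.
- by move=> j q Uq hj; have [] := hol_comp F1 hF1 j q Uq hj.
- by move=> j q Uq hj; have [] := hol_comp F2 hF2 j q Uq hj.
move=> q Uq v; have [hiq hq] := Uball q Uq; have hj := chart_atP q.
have [_ d1] := hol_comp F1 hF1 _ q Uq hj; have [_ d2] := hol_comp F2 hF2 _ q Uq hj.
apply: etrans (sd_form_transition v hj hiq) (etrans (dB _ _ hq) _).
exact: esym (congr2 (fun s t => s * t) (d1 v) (d2 v)).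
Qed.

End Transfer.

Theorem proposition2p7 (R : realType) (n : nat) (X : complexManifold R n)
    (w : symDiff2 X) (w_closed : closed_differential w) (w_rank2 : rank2 w) :
  non_first_kind_locus w `<=` degeneracy_locus w.
Proof.
move=> x nx; apply: contrapT => /not_orP[w0 wH]; apply: nx.
have [a [b [qab [e1 [e2 [a1 a2 b1 b2]]]]]] := hyperplanes_dual_basis w0 wH.
pose i := chart_at x; have hi : cm_dom i x := chart_atP x.
pose B := sd_form w i; pose c := cm_map i x.
(* At [x] the form is the product of a and b, so its polar form on the dual pair takes the values 0,
   0 and 1/2 required by [local_decomposition]. *)
have polar u v : B c u v = (a u * b v + a v * b u) / 2.
  have addl s t z : B c (s + t) z = B c s z + B c t z.
    by have := sd_form_linear w i c z 1 s t; rewrite !scale1r.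
  have E : B c (u + v) (u + v) = B c u u + B c u v + (B c u v + B c v v).
    have symc s t : B c s t = B c t s by exact: sd_form_sym.
    by rewrite addl (symc u (u + v)) (symc v (u + v)) !addl (symc v u).
  exact: (polar_identity E (qab (u + v)) (linearD a u v) (linearD b u v) (qab u) (qab v)).
apply: (local_exact_decomposition hi).
have [A [hA nA gA]] := w_closed.
have [r r0 hr] := chart_ball hi (@filterT _ (nbhs x) _).
apply: (@local_decomposition _ _ B e1 e2 c r r0).
- exact: sd_form_linear.
- by move=> u v z /hr[h1 _ <-]; exact: sd_form_differentiable.
- by move=> z u v /hr[h1 _ <-]; exact: sd_form_sym.
- by rewrite polar a1 b1 mulr0 add0r mul0r.
- by rewrite polar a2 mul0r add0r mul0r.
- by rewrite polar a1 b2 a2 mul0r addr0 mul1r mul1r.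
(* Closedness of [w] enters here: decompositions exist off [A], and the complement of [A] meets
   every ball of the chart. *)
move=> z /hr[h1 _ zE] e e0.
have [q [hq qe] nAq] := proper_analytic_dense hA nA (chart_nbhs h1 e0).
exists (cm_map i q); first by rewrite -zE.
by apply: exact_decomposition_local => //; exact: gA.
Qed.
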